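(* Let $\varphi:\mathbb{R}^d_+\to\mathbb{R}_+$ be a homogeneous function of degree $\theta<-(d+1)$. Then, as $t_1,\dots,t_d\to\infty$, the equivalence $$I_{\mathcal{K}}(\mathbf t)=\mathcal{O}(\varphi(\mathbf t))\quad\Longleftrightarrow\quad\sigma_{h-Ph}=0$$ holds. Here the left-hand relation means that there are constants $C,T>0$ such that $I_{\mathcal K}(\mathbf t)\le C\varphi(\mathbf t)$ for all $\mathbf t\in\mathbb{R}^d_+$ with $t_i\ge T$ for every $1\le i\le d$.
   Context: Let $d\ge1$, $\mathbb{R}_+=(0,\infty)$, $\mathbb{R}^d_+=(0,\infty)^d$; $(\mathbf x,\mathbf y)=\sum_k x_ky_k$ is the standard inner product and $|\mathbf x|=\sqrt{(\mathbf x,\mathbf x)}$. For $\mathbf x,\mathbf t\in\mathbb{R}^d$ put $\mathbf x\odot\mathbf t=(x_1t_1,\dots,x_dt_d)$. $\mathcal{L}_d$ is Lebesgue measure on $\mathbb{R}^d$. The set $\mathcal{K}\subset\mathbb{R}^d$ is convex, compact, $0<\mathcal{L}_d(\mathcal{K})<\infty$, with boundary $\partial\mathcal K$ of class $C^k$ for some integer $k>\max\{1,\frac{d-1}{2}\}$ and everywhere positive Gaussian curvature (for $d=1$, $\mathcal K$ is a compact interval of positive length and the boundary conditions are vacuous). Its indicator has Fourier transform $\mathscr{F}[I_{\mathcal K}](\mathbf x)=\int_{\mathcal K}e^{i(\mathbf y,\mathbf x)}\,d\mathcal{L}_d(\mathbf y)$. Let $\mathcal H$ be a complex Hilbert space,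 $\{U_{\mathbf t}\}_{\mathbf t\in\mathbb{R}^d}$ a strongly continuous unitary representation of $\mathbb{R}^d$ on $\mathcal H$, $P$ the orthogonal projection onto the subspace of vectors fixed by all $U_{\mathbf t}$, and $h\in\mathcal H$. The spectral measure $\sigma_{f}$ of $f\in\mathcal H$ is the finite Borel measure on $\mathbb{R}^d$ with $\langle U_{\mathbf t}f,f\rangle=\int_{\mathbb{R}^d}e^{i(\mathbf t,\mathbf x)}d\sigma_f(\mathbf x)$ for all $\mathbf t$; one has $\sigma_{h-Ph}(\{\mathbf 0\})=0$. Define, for $\mathbf t\in\mathbb{R}^d_+$, $$I_{\mathcal K}(\mathbf t)=\int_{\mathbb{R}^d}\left|\frac{1}{\mathcal{L}_d(\mathcal K)}\mathscr{F}[I_{\mathcal K}](\mathbf x\odot\mathbf t)\right|^2d\sigma_{h-Ph}(\mathbf x),$$ which equals $\left\|\frac{1}{\mathcal{L}_d(\mathcal K\odot\mathbf t)}\int_{\mathcal K\odot\mathbf t}U_{\mathbf s}h\,d\mathcal{L}_d(\mathbf s)-Ph\right\|^2_{\mathcal H}$, where $\mathcal K\odot\mathbf t=\{\mathbf x\odot\mathbf t:\mathbf x\in\mathcal K\}$. A function $\varphi$ on $\mathbb{R}^d_+$ is homogeneous of degree $\theta\in\mathbb{R}$ if $\varphi(r\mathbf x)=r^\theta\varphi(\mathbf x)$ for all $r>0$ and $\mathbf x\in\mathbb{R}^d_+$. *)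

(* Defs.v *)
From HB Require Import structures.
From mathcomp Require Import all_boot all_order all_algebra.
From mathcomp Require Import complex.
From mathcomp Require Import all_classical all_reals all_analysis.

Set Implicit Arguments.
Unset Strict Implicit.
Unset Printing Implicit Defensive.

Import Order.TTheory GRing.Theory Num.Theory.
Import numFieldNormedType.Exports.

Local Open Scope classical_set_scope.
Local Open Scope ring_scope.

(* R^n is 'rV[R]_n, with the Borel sigma-algebra. *)
Section borel_rV.
Context (R : realType) (n : nat).

HB.instance Definition _ := @isMeasurable.Build
  (sigma_display (@open 'rV[R]_n)) 'rV[R]_n <<s @open 'rV[R]_n >>
  (@sigma_algebra0 _ setT _) (@sigma_algebraC _ _) (@sigma_algebra_bigcup _ setT _).

End borel_rV.

Section measurable_rV.
Context (R : realType) (n : nat).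

Lemma open_measurable_rV (A : set 'rV[R]_n) : open A -> measurable A.
Proof. by move=> oA; exact: sub_gen_smallest. Qed.

Lemma measurable_coord (i : 'I_n) :
  measurable_fun setT (fun x : 'rV[R]_n => x ord0 i : R).
Proof.
apply: (measurability _ (measurable_realfun.RGenOpens.measurableE R)).
move=> _ [_ [a [b ->]] <-].
rewrite setTI; apply: open_measurable_rV.
apply: open_comp; last exact: interval_open.
by move=> x _; exact: coord_continuous.
Qed.

(* The converse rests on the second countability of R^n. *)
Lemma measurable_fun_rV d (T : measurableType d) (f : T -> 'rV[R]_n) :
  (forall i, measurable_fun setT (fun t => f t ord0 i : R)) ->
  measurable_fun setT f.
Proof.
move=> mf.
apply: (@measurability _ _ _ _ setT f (@open 'rV[R]_n)) => // _ [A oA <-].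
rewrite setTI.
pose q (c : 'rV[rat]_n) : 'rV[R]_n := map_mx ratr c.
pose ok (c : 'rV[rat]_n * nat) := ball (q c.1) (c.2.+1%:R^-1) `<=` A.
pose B (c : 'rV[rat]_n * nat) (i : 'I_n) :=
  (fun t => f t ord0 i : R) @^-1` (ball (q c.1 ord0 i) (c.2.+1%:R^-1)).
pose S c := if `[< ok c >] then \bigcap_(i in setT) B c i else set0.
have -> : f @^-1` A = \bigcup_(c in setT) S c.
  apply/seteqP; split => [t /= At|t [c _]]; last first.
    rewrite /S; case: asboolP => //= okc tc; apply: okc; split => // i j.
    by rewrite (ord1 i); apply: tc.
  have /nbhs_ballP[e /= e0 sA] : nbhs (f t) A by exact: open_nbhs_nbhs.
  have [k] : exists k : nat, 0 + k.+1%:R^-1 < e / 2.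
    by apply: ltr_add_invr; rewrite divr_gt0.
  rewrite add0r => ke.
  have k0 : 0 < k.+1%:R^-1 :> R by rewrite invr_gt0.
  have /choice[g gP] (j : 'I_n) : exists r : rat,
      ball (ratr r : R) k.+1%:R^-1 (f t ord0 j).
    have : f t ord0 j - k.+1%:R^-1 < f t ord0 j + k.+1%:R^-1.
      by rewrite ltrBlDr -addrA ltrDl addr_gt0.
    move=> /rat_in_itvoo[r]; rewrite in_itv/= => rf; exists r.
    by rewrite -ball_normE/= ltr_distl.
  exists (\row_j g j, k) => //; rewrite /S asboolT.
    by move=> j _; rewrite /B /q /= !mxE; exact: gP.
  move=> y [_ /= qy]; apply: sA; split => // i j.
  rewrite (ord1 i); apply: (@le_ball _ _ _ (k.+1%:R^-1 + k.+1%:R^-1)).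
    by rewrite [leRHS]splitr lerD// ltW.
  apply: (@ball_triangle _ _ (q (\row_j g j) ord0 j)).
    by rewrite /q !mxE; apply: ball_sym; exact: gP.
  exact: qy.
apply: countable_bigcupT_measurable => [|c]; first exact: countableP.
rewrite /S; case: asboolP => _ //; apply: fin_bigcap_measurable => // i _.
rewrite -[X in measurable X]setTI; apply: mf => //.
exact: measurable_realfun.measurable_ball.
Qed.

End measurable_rV.

Section lebesgue_rV.
Context (R : realType).

Definition cons_rV n (p : R * 'rV[R]_n) : 'rV[R]_n.+1 :=
  row_mx (p.1%:M : 'rV_1) p.2.

Definition uncons_rV n (x : 'rV[R]_n.+1) : R * 'rV[R]_n :=
  (x ord0 ord0, \row_j x ord0 (lift ord0 j)).

Lemma cons_rV0 n (p : R * 'rV[R]_n) : cons_rV p ord0 ord0 = p.1.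
Proof.
have -> : ord0 = lshift n (ord0 : 'I_1) by apply: val_inj.
by apply: etrans (row_mxEl _ _ _ _) _; rewrite mxE eqxx mulr1n.
Qed.

Lemma cons_rVS n (p : R * 'rV[R]_n) j : cons_rV p ord0 (lift ord0 j) = p.2 ord0 j.
Proof.
have -> : lift ord0 j = rshift 1 j by apply: val_inj.
exact: row_mxEr.
Qed.

Lemma cons_rVK n : cancel (@cons_rV n) (@uncons_rV n).
Proof.
move=> [a v]; rewrite /uncons_rV cons_rV0; congr (_, _).
by apply/rowP => j; rewrite mxE cons_rVS.
Qed.

Lemma uncons_rVK n : cancel (@uncons_rV n) (@cons_rV n).
Proof.
move=> x; apply/rowP => j; have [i ->|->] := unliftP ord0 j.
  by rewrite cons_rVS mxE.
by rewrite cons_rV0.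
Qed.

Lemma measurable_cons_rV n : measurable_fun setT (@cons_rV n).
Proof.
apply: measurable_fun_rV => j; have [i ->|->] := unliftP ord0 j.
  under eq_fun do rewrite cons_rVS.
  exact: (measurableT_comp (measurable_coord i) measurable_snd).
under eq_fun do rewrite cons_rV0.
exact: measurable_fst.
Qed.

Lemma measurable_uncons_rV n : measurable_fun setT (@uncons_rV n).
Proof.
apply: measurable_fun_pair; first exact: measurable_coord.
apply: measurable_fun_rV => j; under eq_fun do rewrite mxE.
exact: measurable_coord.
Qed.

(* Image of the product of the Lebesgue measure on R with m. *)
Definition cons_measure n (m : {sigma_finite_measure set 'rV[R]_n -> \bar R}) :
    set 'rV[R]_n.+1 -> \bar R :=
  pushforward ((@lebesgue_measure R) \x m)%E (@cons_rV n).

Section cons_measure.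
Context n (m : {sigma_finite_measure set 'rV[R]_n -> \bar R}).

Let m0 : cons_measure m set0 = 0%E.
Proof. by rewrite /cons_measure /pushforward preimage_set0 measure0. Qed.

Let mge0 A : (0 <= cons_measure m A)%E.
Proof. by rewrite /cons_measure /pushforward measure_ge0. Qed.

Let madd : semi_sigma_additive (cons_measure m).
Proof.
move=> F mF tF mUF; rewrite /cons_measure /pushforward preimage_bigcup.
apply: measure_semi_sigma_additive.
- by move=> k; rewrite -[X in measurable X]setTI; exact: measurable_cons_rV.
- apply/trivIsetP => /= i j _ _ ij; rewrite -preimage_setI.
  by move/trivIsetP : tF => /(_ _ _ _ _ ij) ->//; rewrite preimage_set0.
- rewrite -preimage_bigcup -[X in measurable X]setTI.
  exact: measurable_cons_rV.
Qed.

HB.instance Definition _ := isMeasure.Build _ _ _ (cons_measure m) m0 mge0 madd.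

Let msf : sigma_finite setT (cons_measure m).
Proof.
have /sigma_finiteP[F [FT ndF Foo]] := sigma_finiteT (@lebesgue_measure R).
have /sigma_finiteP[G [GT ndG Goo]] := sigma_finiteT m.
exists (fun k => @uncons_rV n @^-1` (F k `*` G k)).
  rewrite -preimage_bigcup; apply/seteqP; split => // x _ /=.
  have [i _ Fi] : (\bigcup_i F i) (uncons_rV x).1 by rewrite -FT.
  have [j _ Gj] : (\bigcup_j G j) (uncons_rV x).2 by rewrite -GT.
  exists (maxn i j) => //; split.
    by move: Fi; exact/subsetPset/ndF/leq_maxl.
  by move: Gj; exact/subsetPset/ndG/leq_maxr.
move=> k; have [mF Fk] := Foo k; have [mG Gk] := Goo k; split.
  rewrite -[X in measurable X]setTI; apply: measurable_uncons_rV => //.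
  exact: measurableX.
rewrite /cons_measure /pushforward -comp_preimage.
rewrite (_ : _ \o _ = id); last by apply/funext => x /=; rewrite cons_rVK.
rewrite preimage_id product_measure1E//.
by rewrite lte_mul_pinfty// ge0_fin_numE.
Qed.

HB.instance Definition _ := Measure_isSigmaFinite.Build _ _ _ (cons_measure m) msf.

End cons_measure.

(* R^0 is a point, of measure 1. *)
Fixpoint lebesgue_rV n : {sigma_finite_measure set 'rV[R]_n -> \bar R} :=
  match n with
  | 0 => dirac (0 : 'rV[R]_0)
  | n'.+1 => cons_measure (lebesgue_rV n')
  end.

Lemma measurable_box_rV n (a b : 'rV[R]_n) :
  measurable [set x : 'rV[R]_n | forall i, a ord0 i <= x ord0 i <= b ord0 i].
Proof.
have -> : [set x : 'rV[R]_n | forall i, a ord0 i <= x ord0 i <= b ord0 i] =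
    \bigcap_(i in setT)
      (fun x : 'rV[R]_n => x ord0 i : R) @^-1` `[a ord0 i, b ord0 i].
  apply/seteqP; split => [x xab i _|x xab i] /=; first by rewrite in_itv/=.
  by have := xab i I; rewrite /= in_itv.
apply: fin_bigcap_measurable => // i _.
by rewrite -[X in measurable X]setTI; apply: measurable_coord.
Qed.

Lemma lebesgue_rV_box n (a b : 'rV[R]_n) : (forall i, a ord0 i <= b ord0 i) ->
  lebesgue_rV n [set x : 'rV[R]_n | forall i, a ord0 i <= x ord0 i <= b ord0 i] =
  (\prod_(i < n) (b ord0 i - a ord0 i))%:E.
Proof.
elim: n => [|n IH] in a b *; move=> ab.
  by rewrite big_ord0 /= diracE mem_set// => -[].
rewrite big_ord_recl/= /cons_measure /pushforward.
pose a' : 'rV[R]_n := \row_j a ord0 (lift ord0 j).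
pose b' : 'rV[R]_n := \row_j b ord0 (lift ord0 j).
have -> : @cons_rV n @^-1`
      [set x : 'rV[R]_n.+1 | forall i, a ord0 i <= x ord0 i <= b ord0 i] =
    `[a ord0 ord0, b ord0 ord0]%classic `*`
      [set x : 'rV[R]_n | forall i, a' ord0 i <= x ord0 i <= b' ord0 i].
  apply/seteqP; split => [x /= xab|x /= [x1 x2] i].
    split; first by have := xab ord0; rewrite cons_rV0 in_itv.
    by move=> i; have := xab (lift ord0 i); rewrite cons_rVS !mxE.
  have [j ->|->] := unliftP ord0 i; last by move: x1; rewrite cons_rV0 in_itv.
  by have := x2 j; rewrite cons_rVS !mxE.
rewrite product_measure1E//; last exact: measurable_box_rV.
have leb_ab : @lebesgue_measure R `[a ord0 ord0, b ord0 ord0]%classic =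
    (b ord0 ord0 - a ord0 ord0)%:E.
  rewrite lebesgue_measure_itv/= lte_fin.
  have := ab ord0; rewrite le_eqVlt => /predU1P[->|->]; last by [].
  by rewrite ltxx subrr.
have ab' i : a' ord0 i <= b' ord0 i by rewrite !mxE.
rewrite (IH _ _ ab') (eq_bigr (fun i => b ord0 (lift ord0 i) - a ord0 (lift ord0 i))).
  by rewrite EFinM; congr (_ * _)%E; exact: leb_ab.
by move=> i _; rewrite !mxE.
Qed.

End lebesgue_rV.

Section complex_integral.
Context d (T : measurableType d) (R : realType).

Definition expi (u : R) : R[i] := (cos u +i* sin u)%C.

Definition Cintegral (mu : {measure set T -> \bar R}) (D : set T)
    (f : T -> R[i]) : R[i] :=
  (Rintegral mu D (fun x => complex.Re (f x)) +i*
   Rintegral mu D (fun x => complex.Im (f x)))%C.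

End complex_integral.

Section euclidean.
Context (R : realType) (d : nat).
Implicit Types (x y t p : 'rV[R]_d) (K V : set 'rV[R]_d).

Definition dotv x y : R := \sum_(i < d) x ord0 i * y ord0 i.

Definition normv x : R := Num.sqrt (dotv x x).

Definition odot x t : 'rV[R]_d := \row_i (x ord0 i * t ord0 i).

Definition orthant : set 'rV[R]_d := [set t | forall i, 0 < t ord0 i].

Definition homogeneous (theta : R) (phi : 'rV[R]_d -> R) :=
  forall r x, 0 < r -> orthant x -> phi (r *: x) = r `^ theta * phi x.

Definition fourier_indic K x : R[i] :=
  Cintegral (lebesgue_rV R d) K (fun y => expi (dotv y x)).

(* Meant for V open, so that values of f outside V are irrelevant. *)
Fixpoint class_C (k : nat) V (f : 'rV[R]_d -> R) : Prop :=
  match k with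
  | 0 => forall x, V x -> {for x, continuous f}
  | k'.+1 => (forall x, V x -> differentiable f x) /\
             (forall v, class_C k' V (fun x => 'D_v f x))
  end.

Definition grad (f : 'rV[R]_d -> R) x : 'rV[R]_d :=
  \row_i 'D_(delta_mx ord0 i) f x.

Definition boundary K := closure K `\` K°.

(* Near the boundary point p, K is a sublevel set of rho and the boundary of K
   is its zero set; grad rho points out of K. *)
Definition defining_function (k : nat) K p V (rho : 'rV[R]_d -> R) :=
  [/\ open V, V p, class_C k V rho, forall x, V x -> grad rho x != 0 &
      forall x, V x -> (K x <-> rho x <= 0)].

Definition boundary_class (k : nat) K :=
  forall p, boundary K p -> exists V rho, defining_function k K p V rho.

(* With this outward orientation the unit sphere has curvature 1 in every
   dimension. *)
Definition gauss_map (rho : 'rV[R]_d -> R) x : 'rV[R]_d :=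
  (normv (grad rho x))^-1 *: grad rho x.

(* The rows of E form an orthonormal basis of the tangent space at p of the
   level set of rho. *)
Definition tangent_frame (rho : 'rV[R]_d -> R) p (E : 'M[R]_(d.-1, d)) :=
  E *m E^T = 1%:M /\ E *m (grad rho p)^T = 0.

(* c is the determinant of the shape operator, the differential of the outer
   Gauss map on the tangent space, written in an orthonormal basis. *)
Definition gaussian_curvature K p (c : R) :=
  exists V rho E, [/\ defining_function 2 K p V rho, tangent_frame rho p E &
    c = \det (E *m 'J (gauss_map rho) p *m E^T)].

Definition positively_curved K :=
  forall p, boundary K p -> exists2 c, gaussian_curvature K p c & 0 < c.

End euclidean.

Section unitary_representations.
Context (R : realType) (d : nat) (H : completeNormedModType R[i]).
Variable dot : {dot H for Num.conj}.

(* The norm of H comes from the inner product, which makes H a Hilbert space. *)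
Definition hilbert := forall f : H, `|f| ^+ 2 = dot f f.

(* Each U t is unitary: it is isometric, and onto by the group law. *)
Definition unitary_rep (U : 'rV[R]_d -> {linear H -> H}) :=
  [/\ forall f, U 0 f = f, forall s t f, U (s + t) f = U s (U t f),
      forall t f g, dot (U t f) (U t g) = dot f g &
      forall f, continuous (fun t => U t f)].

Definition fixed_by (U : 'rV[R]_d -> {linear H -> H}) : set H :=
  [set f | forall t, U t f = f].

Definition orthogonal_projection (E : set H) (P : H -> H) :=
  forall f, E (P f) /\ forall g, E g -> dot (f - P f) g = 0.

Definition spectral_measure (U : 'rV[R]_d -> {linear H -> H}) (f : H)
    (sigma : {finite_measure set 'rV[R]_d -> \bar R}) :=
  forall t, dot (U t f) f = Cintegral sigma setT (fun x => expi (dotv t x)).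

End unitary_representations.

(* With sigma the spectral measure of h - P h, this is the squared distance in H
   from P h to the average of U_s h over s in K odot t. *)
Definition averaging_error (R : realType) (d : nat) (K : set 'rV[R]_d)
    (sigma : {finite_measure set 'rV[R]_d -> \bar R}) (t : 'rV[R]_d) : \bar R :=
  (\int[sigma]_x
     ((ComplexField.Normc.normc
         (((fine (lebesgue_rV R d K))^-1)%:C%C *
          fourier_indic K (odot x t))) ^+ 2)%:E)%E.

(* Main.v *)
Require Import Defs.
From mathcomp Require Import all_boot all_order all_algebra.
From mathcomp Require Import complex.
From mathcomp Require Import all_classical all_reals all_analysis.
From mathcomp Require Import measurable_realfun.
From mathcomp Require Import ring lra.

Set Implicit Arguments.
Unset Strict Implicit.
Unset Printing Implicit Defensive.

Import Order.TTheory GRing.Theory Num.Theory.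
Import numFieldNormedType.Exports.

Local Open Scope classical_set_scope.
Local Open Scope ring_scope.

(* Only the diagonal t = (r, ..., r) is needed.  Write F for the Fourier transform
   of the indicator of K, and let s0 be the minimum over K of the linear form
   y |-> (x, y), for x != 0.  The boundary of K being C^2, K contains a paraboloid
   touching it at the minimizer, so the caps {y in K | (x, y) <= s0 + e^2} have
   volume at least c e^(d+1).  The weight w(r) = r^m e^(-r) on the half-line has the
   cosine transform g(s) = m! Re (1 - is)^-(m+1), which is positive for s >= L as
   soon as 4 divides m + 1.  Fubini turns the integral over K of
   g(lambda ((x, y) - s0) + L), which is at least c' lambda^-((d+1)/2) by the cap
   estimate, into an average of phase-shifted values of F(lambda r x) with weight w;
   hence the average over r of |F(lambda r x)|^2 is at least c'' lambda^-(d+1).  The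
   hypothesis makes the sigma-integral of this average O(lambda^theta), with
   theta < -(d+1), so sigma vanishes outside the origin.

   The origin is not an atom either.  By the parallelogram law, a sequence minimizing
   the norm on the affine hull of the orbit of f = h - P h converges to a vector fixed
   by U, hence orthogonal to that hull; so the minimal norm is 0, whereas every affine
   combination v of the vectors U_t f satisfies |v|^2 >= sigma {0}. *)

(** * The spectral measure has no atom at the origin *)

Section spectral_atom.
Context (R : realType) (d : nat) (H : completeNormedModType R[i]).
Variables (dot : {dot H for Num.conj}) (H_hilbert : hilbert dot).
Variables (U : 'rV[R]_d -> {linear H -> H}) (U_rep : unitary_rep dot U).
Variables (f : H) (sigma : {finite_measure set 'rV[R]_d -> \bar R}).
Hypothesis sigma_spec : spectral_measure dot U f sigma.
Implicit Types (u v : H) (s t x : 'rV[R]_d) (l : seq (R * 'rV[R]_d)).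

Let sqn u : R := complex.Re (dot u u).
Let nrm u : R := complex.Re `|u|.

(** A nonnegative element of [R[i]] has zero imaginary part, and [dot u u] is the square of a
    norm. *)
Let dotE u : dot u u = (sqn u)%:C%C.
Proof.
have := exprn_ge0 2 (normr_ge0 u); rewrite H_hilbert /sqn.
by case: (dot u u) => a b; rewrite lecE/= => /andP[/eqP -> _].
Qed.

Let normE u : `|u| = (nrm u)%:C%C.
Proof.
have := normr_ge0 u; rewrite /nrm.
by case: `|u| => a b; rewrite lecE/= => /andP[/eqP -> _].
Qed.

Let nrm_ge0 u : 0 <= nrm u.
Proof. by have := normr_ge0 u; rewrite normE lecE/= => /andP[]. Qed.

Let sqnE u : sqn u = nrm u ^+ 2.
Proof. by have := H_hilbert u; rewrite normE dotE -rmorphXn/= => -[->]. Qed.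

Let nrmD u v : nrm (u + v) <= nrm u + nrm v.
Proof. by have := ler_normD u v; rewrite !normE -rmorphD/= lecR. Qed.

Let parallelogram u v : sqn (u + v) + sqn (u - v) = 2 * sqn u + 2 * sqn v.
Proof.
have : dot (u + v) (u + v) + dot (u - v) (u - v) = 2 * dot u u + 2 * dot v v.
  by rewrite hnormD hnormB; ring.
rewrite !dotE -!rmorphD/= => h.
have : (sqn (u + v) + sqn (u - v))%:C%C = (2 * sqn u + 2 * sqn v)%:C%C :> R[i].
  by rewrite h rmorphD !rmorphM/= !rmorph_nat.
by case.
Qed.

(** Real coefficients are enough: midpoints of combinations and their images under [U] keep them
    real. *)
Definition orbit_comb l : H := \sum_(p <- l) p.1%:C%C *: U p.2 f.
(** [C l + i S l] is the trigonometric polynomial that represents [orbit_comb l] in the L^2 space of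
    [sigma]. *)
Let C l x : R := \sum_(p <- l) p.1 * cos (dotv p.2 x).
Let S l x : R := \sum_(p <- l) p.1 * sin (dotv p.2 x).

Let measurable_dotv t : measurable_fun setT (dotv t).
Proof.
apply: measurable_sum => i; apply: measurable_funM => //.
exact: measurable_coord.
Qed.

Let measurable_C l : measurable_fun setT (C l).
Proof.
apply: measurable_sum => p; apply: measurable_funM => //.
apply: measurableT_comp => //.
exact: continuous_measurable_fun (@continuous_cos R).
Qed.

Let measurable_S l : measurable_fun setT (S l).
Proof.
apply: measurable_sum => p; apply: measurable_funM => //.
apply: measurableT_comp => //.
exact: continuous_measurable_fun (@continuous_sin R).
Qed.

Let integrable_bounded (g : 'rV[R]_d -> R) (M : R) : measurable_fun setT g ->
  (forall x, `|g x| <= M) -> sigma.-integrable setT (EFin \o g).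
Proof.
move=> mg gM; apply: measurable_bounded_integrable => //.
  by rewrite ltey_eq fin_num_measure.
exists M; split; first by rewrite num_real.
by move=> N MN x _ /=; exact: le_trans (gM x) (ltW MN).
Qed.

Let integrable_CS l l' :
  sigma.-integrable setT (EFin \o (fun x => C l x * C l' x + S l x * S l' x)).
Proof.
pose N l : R := \sum_(p <- l) `|p.1|.
have CN l1 x : `|C l1 x| <= N l1.
  rewrite /C (le_trans (ler_norm_sum _ _ _))// ler_sum// => p _.
  by rewrite normrM ler_piMr// cos_max.
have SN l1 x : `|S l1 x| <= N l1.
  rewrite /S (le_trans (ler_norm_sum _ _ _))// ler_sum// => p _.
  by rewrite normrM ler_piMr// sin_max.
apply: (@integrable_bounded _ (N l * N l' + N l * N l')).
  by apply: measurable_funD; apply: measurable_funM.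
move=> x; rewrite (le_trans (ler_normD _ _))// !normrM lerD// ler_pM//.
Qed.

(** Unitarity reduces the left side to [dot (U (s - t) f) f], so the spectral measure yields the
    integral of the cosine of a difference. *)
Let Re_dot1 s t : complex.Re (dot (U s f) (U t f)) =
  \int[sigma]_x (cos (dotv s x) * cos (dotv t x) + sin (dotv s x) * sin (dotv t x)).
Proof.
have [U0 UD Uu _] := U_rep.
have -> : dot (U s f) (U t f) = dot (U (s - t) f) f.
  by rewrite -[in RHS](Uu t) -UD [t + _]addrC subrK.
rewrite sigma_spec /=; congr fine; apply: eq_integral => x _; congr EFin.
rewrite -cosB; congr cos; rewrite /dotv -sumrB; apply: eq_bigr => i _.
by rewrite !mxE mulrBl.
Qed.

Let Re_scale (a : R) (z : R[i]) : complex.Re (a%:C%C * z) = a * complex.Re z.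
Proof. by case: z => x y /=; rewrite mul0r subr0. Qed.

Let C1 a t x : C [:: (a, t)] x = a * cos (dotv t x).
Proof. by rewrite /C big_seq1. Qed.

Let S1 a t x : S [:: (a, t)] x = a * sin (dotv t x).
Proof. by rewrite /S big_seq1. Qed.

Let C_cons p l x : C (p :: l) x = C [:: p] x + C l x.
Proof. by rewrite /C big_cons big_seq1. Qed.

Let S_cons p l x : S (p :: l) x = S [:: p] x + S l x.
Proof. by rewrite /S big_cons big_seq1. Qed.

Let Re_dot_single p l' : complex.Re (dot (orbit_comb [:: p]) (orbit_comb l')) =
  \int[sigma]_x (C [:: p] x * C l' x + S [:: p] x * S l' x).
Proof.
case: p => a s; elim: l' => [|[b t] l IH].
  rewrite {2}/orbit_comb big_nil linear0r.
  under eq_Rintegral do rewrite /C /S big_nil big_nil !mulr0 addr0.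
  by rewrite Rintegral_cst//= mul0r.
rewrite {2}/orbit_comb big_cons -/(orbit_comb l) linearDr raddfD/= IH.
under [RHS]eq_Rintegral => x _.
  rewrite (C_cons (b, t) l) (S_cons (b, t) l) !mulrDr addrACA; over.
rewrite [RHS]RintegralD//; congr (_ + _).
rewrite /orbit_comb big_seq1/= linearZl_LR linearZr_LR/= Re_scale.
have -> : complex.Re (Num.conj (b%:C)%C * dot (U s f) (U t f)) =
    b * complex.Re (dot (U s f) (U t f)).
  by case: (dot _ _) => x y /=; ring.
rewrite Re_dot1 mulrA -RintegralZl//.
  by apply: eq_Rintegral => x _; rewrite !C1 !S1; ring.
have /= := integrable_CS [:: (1, s)] [:: (1, t)].
by under eq_fun do rewrite !C1 !S1 !mul1r.
Qed.

(** By bilinearity from [Re_dot1]; for [l = l'] the integrand is the squared modulus of the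
    trigonometric polynomial. *)
Let Re_dot l l' : complex.Re (dot (orbit_comb l) (orbit_comb l')) =
  \int[sigma]_x (C l x * C l' x + S l x * S l' x).
Proof.
elim: l => [|p l IH].
  rewrite {1}/orbit_comb big_nil linear0l.
  under eq_Rintegral do rewrite /C /S big_nil big_nil !mul0r addr0.
  by rewrite Rintegral_cst//= mul0r.
rewrite {1}/orbit_comb big_cons -/(orbit_comb l) linearDl raddfD/= IH.
under [RHS]eq_Rintegral => x _.
  rewrite (C_cons p l) (S_cons p l) !mulrDl addrACA; over.
rewrite [RHS]RintegralD//; congr (_ + _).
by rewrite -Re_dot_single /orbit_comb big_seq1.
Qed.

Lemma measurable_origin : measurable [set (0 : 'rV[R]_d)].
Proof.
rewrite -[X in measurable X]setCK; apply: measurableC; apply: open_measurable_rV.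
exact/closed_openC/accessible_closed_set1/hausdorff_accessible/norm_hausdorff.
Qed.

(** At the origin the trigonometric polynomial equals the sum of its coefficients, here 1, so the
    integral of its squared modulus is at least the mass of the origin. *)
Let orbit_comb_lb l : \sum_(p <- l) p.1 = 1 -> fine (sigma [set 0]) <= sqn (orbit_comb l).
Proof.
move=> l1; rewrite /sqn Re_dot.
have -> : fine (sigma [set 0]) = \int[sigma]_(x in [set (0 : 'rV[R]_d)]) 1.
  by rewrite Rintegral_cst ?mul1r//; exact: measurable_origin.
rewrite Rintegral_mkcond; apply: le_Rintegral => //.
- apply: (@integrable_bounded _ 1) => [|x].
    exact: (measurable_restrictT _ measurable_origin).1 (measurable_cst _).
  by rewrite patchE; case: ifP => _; rewrite ?normr1 ?normr0.
- move=> x _; rewrite patchE; case: ifPn => [|_]; last by rewrite addr_ge0// -expr2 sqr_ge0.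
  rewrite inE => ->.
  have -> : C l 0 = 1.
    rewrite -l1; apply: eq_bigr => p _.
    rewrite (_ : dotv _ _ = 0) ?cos0 ?mulr1//.
    by apply: big1 => i _; rewrite mxE mulr0.
  by rewrite mulr1 lerDl -expr2 sqr_ge0.
Qed.

Let affine : set H := [set v | exists2 l, \sum_(p <- l) p.1 = 1 & v = orbit_comb l].

Let orbit_comb_cat l l' : orbit_comb (l ++ l') = orbit_comb l + orbit_comb l'.
Proof. by rewrite /orbit_comb big_cat. Qed.

Let affine_mid u v : affine u -> affine v -> affine ((2^-1)%:C%C *: (u + v)).
Proof.
move=> [l l1 ->] [l' l'1 ->].
exists [seq (2^-1 * p.1, p.2) | p <- l ++ l'].
  rewrite big_map/= -mulr_sumr big_cat/= l1 l'1; lra.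
rewrite -orbit_comb_cat /orbit_comb big_map scaler_sumr.
by apply: eq_bigr => p _; rewrite scalerA -rmorphM.
Qed.

Let affine_U t v : affine v -> affine (U t v).
Proof.
move=> [l l1 ->]; have [_ UD _ _] := U_rep.
exists [seq (p.1, t + p.2) | p <- l]; first by rewrite big_map.
rewrite /orbit_comb big_map linear_sum; apply: eq_bigr => p _.
by rewrite linearZ UD.
Qed.

Let sqnU t v : sqn (U t v) = sqn v.
Proof. by have [_ _ Uu _] := U_rep; rewrite /sqn Uu. Qed.

Let sqnZ (a : R) v : sqn (a%:C%C *: v) = a ^+ 2 * sqn v.
Proof.
by rewrite /sqn linearZl_LR linearZr_LR/= Re_scale; case: (dot v v) => x y /=; ring.
Qed.

(** Parallelogram law: the midpoint of [u] and [v] stays in the affine hull, so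
    [sqn (u + v) >= 4 * D]. *)
Let affineB_le D u v : (forall w, affine w -> D <= sqn w) ->
  affine u -> affine v -> sqn (u - v) <= 2 * sqn u + 2 * sqn v - 4 * D.
Proof.
move=> hD au av; rewrite -parallelogram -addrA addrCA lerDl subr_ge0.
have := hD _ (affine_mid au av); rewrite sqnZ; lra.
Qed.

Let nrmE_lt (e : R) u : 0 < e -> sqn u < e ^+ 2 -> nrm u < e.
Proof. by move=> e0; rewrite sqnE ltr_pXn2r// nnegrE ?nrm_ge0// ltW. Qed.

Lemma spectral_measure_atom0 :
  (forall g, fixed_by U g -> dot f g = 0) -> sigma [set 0] = 0%E.
Proof.
move=> f_fix; have [U0 UD Uu _] := U_rep.
have sqn_ge0 u : 0 <= sqn u by rewrite sqnE sqr_ge0.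
pose E := [set sqn v | v in affine]; pose D := inf E.
have lbE : has_lbound E by exists 0 => _ [v _ <-].
have infE : has_inf E.
  split=> //; exists (sqn (orbit_comb [:: (1, 0)])).
  by exists (orbit_comb [:: (1, 0)]) => //; exists [:: (1, 0)]; rewrite ?big_seq1.
have leD w : affine w -> D <= sqn w by move=> aw; apply: ge_inf => //; exists w.
have /choice[v hv] (n : nat) : exists v, affine v /\ sqn v < D + n.+1%:R^-1.
  have n0 : 0 < n.+1%:R^-1 :> R by rewrite invr_gt0.
  by have [_ [v av <-] lv] := inf_adherent n0 infE; exists v.
(* For two terms within [1 / (N + 1)] of the infimum, [affineB_le] bounds the squared distance by
   [4 / (N + 1)]. *)
have small (e : R) : 0 < e -> exists N : nat, 4 * N.+1%:R^-1 < e ^+ 2.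
  move=> e0; have [] := @near_infty_natSinv_lt R (PosNum (_ : 0 < e ^+ 2 / 4)).
    by rewrite divr_gt0 ?exprn_gt0.
  move=> e40 N _ /(_ N (leqnn N))/=; exists N.
  by rewrite mulrC -ltr_pdivlMr.
have le_inv (N n : nat) : (N <= n)%N -> n.+1%:R^-1 <= N.+1%:R^-1 :> R.
  by move=> Nn; rewrite lef_pV2 ?posrE// ler_nat.
have cv : cauchy (v n @[n --> \oo]).
  apply: cauchy_exP => -[e1 e2]; rewrite ltcE/= => /andP[/eqP -> e0].
  have [N hN] := small _ e0; exists (v N); exists N => // n /= Nn.
  rewrite -ball_normE/= normE ltcR; apply: nrmE_lt => //.
  apply: le_lt_trans hN; have [aN] := hv N; have [an] := hv n.
  move: (le_inv _ _ Nn) (affineB_le leD aN an).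
  by move: (N.+1%:R^-1) (n.+1%:R^-1) => a b; lra.
have [g vg] : exists g : H, v n @[n --> \oo] --> g.
  by exists (lim (v n @[n --> \oo])); exact: cauchy_cvg.
have near_g (e : R) : 0 < e -> exists N, forall n, (N <= n)%N -> nrm (v n - g) < e.
  move=> e0; have eC : 0 < e%:C%C :> R[i] by rewrite ltcR.
  move/cvgrPdist_lt: vg => /(_ _ eC)[N _ hN]; exists N => n Nn.
  by have := hN n Nn; rewrite /= distrC normE ltcR.
(* [U s] preserves the affine hull and the norm, so [U s (v n)] is nearly minimal too and hence
   close to [v n]; three errors of [e / 3] then compare [U s g] with [g]. *)
have g_fix : fixed_by U g.
  move=> s; apply/eqP; rewrite -subr_eq0 -normr_eq0 normE.
  suff : nrm (U s g - g) <= 0.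
    by move=> h; rewrite (@le_anti _ _ (nrm _) 0) ?h ?nrm_ge0.
  apply/ler_addgt0Pr => e e0; rewrite add0r.
  have e30 : 0 < e / 3 by rewrite divr_gt0.
  have [N hN] := near_g _ e30; have [M hM] := small _ e30.
  pose n := maxn N M; have [an ln] := hv n.
  have h1 := hN n (leq_maxl _ _); have h2 := le_inv _ _ (leq_maxr N M).
  have h3 : nrm (U s (v n) - v n) < e / 3.
    apply: nrmE_lt => //; apply: le_lt_trans hM.
    move: (affineB_le leD (affine_U s an) an) h2 ln; rewrite sqnU -/n.
    by move: (n.+1%:R^-1) (M.+1%:R^-1) => a b; lra.
  have h4 : nrm (U s g - U s (v n)) < e / 3.
    by apply: nrmE_lt => //; rewrite -linearB/= sqnU -opprB -scaleN1r
      -[-1](rmorphN1 (real_complex R)) sqnZ sqrrN expr1n mul1r sqnE ltr_pXn2r// nnegrE ?nrm_ge0// ltW.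
  have -> : U s g - g = (U s g - U s (v n)) + ((U s (v n) - v n) + (v n - g)).
    by rewrite (addrA (U s (v n) - _)) subrK (addrA (U s g - _)) subrK.
  have := nrmD (U s g - U s (v n)) ((U s (v n) - v n) + (v n - g)).
  have := nrmD (U s (v n) - v n) (v n - g); lra.
(* As [g] is fixed, [dot (U t f) g = dot (U t f) (U t g) = dot f g = 0]. *)
have vg0 n : dot (v n) g = 0.
  have [[l _ ->] _] := hv n; rewrite /orbit_comb.
  elim/big_rec: _ => [|p w _ IH]; first by rewrite linear0l.
  by rewrite linearDl /= [X in _ + X]IH linearZl_LR/= -[X in dot _ X](g_fix p.2) Uu f_fix// mulr0 addr0.
have s0 : 0 <= fine (sigma [set 0]) by exact: fine_ge0.
suff : fine (sigma [set 0]) <= 0.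
  move=> h; have /eqP : fine (sigma [set 0]) = 0 by apply: le_anti; rewrite h.
  rewrite fine_eq0; first by move/eqP.
  by apply: fin_num_measure; exact: measurable_origin.
apply/ler_addgt0Pr => e e0; rewrite add0r.
have se0 : 0 < Num.sqrt e by rewrite sqrtr_gt0.
have [N /(_ N (leqnn N)) hN] := near_g _ se0.
have [[l l1 vl] _] := hv N.
apply: le_trans (orbit_comb_lb l1) _; rewrite -vl.
(* Pythagoras: [v N] is orthogonal to [g], so [sqn (v N) <= sqn (v N - g)], which is below [e]
   because the distance is below its square root. *)
apply: (@le_trans _ _ (sqn (v N - g))).
  suff -> : sqn (v N - g) = sqn (v N) + sqn g by rewrite lerDl.
  rewrite /sqn hnormBd ?vg0//.
    have ReD (z w : R[i]) : complex.Re (z + w) = complex.Re z + complex.Re w.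
      by case: z w => ? ? [].
    exact: ReD.
  exact: vg0.
by rewrite sqnE -[leRHS](sqr_sqrtr (ltW e0)) ler_pXn2r ?(ltW hN)// nnegrE ?nrm_ge0// ltW.
Qed.

End spectral_atom.

(** * A cosine transform that is eventually positive *)

Section gamma_kernel.
Context (R : realType).
Implicit Types (r s : R) (m n : nat).

Lemma cvgr_inv_pinfty : r^-1 @[r --> +oo] --> (0 : R).
Proof.
apply/cvgrVy; first by near=> r; rewrite invr_gt0; near: r; exact: nbhs_pinfty_gt.
by rewrite [X in X @ _ --> _](_ : _ = id) ?cvg_id//; apply/funext => r; exact: invrK.
Unshelve. all: by end_near. Qed.

Definition gamma_weight m r : R := r ^+ m * expR (- r).

Lemma gamma_weight_ge0 m r : 0 <= r -> 0 <= gamma_weight m r.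
Proof. by move=> r0; rewrite mulr_ge0 ?exprn_ge0 ?expR_ge0. Qed.

Lemma continuous_gamma_weight m : continuous (gamma_weight m).
Proof.
move=> r; apply: cvgM; first exact: exprn_continuous.
by apply: continuous_comp; [exact: continuousN|exact: continuous_expR].
Qed.

(** Since e^r >= 1 + r^(m+1) / (m+1)!, the weight is at most (m+1)! / r. *)
Lemma gamma_weight_cvgy m : gamma_weight m r @[r --> +oo] --> (0 : R).
Proof.
have c0 : (m.+1`!)%:R * r^-1 @[r --> +oo] --> (0 : R).
  by rewrite -[X in _ --> X](mulr0 (m.+1`!)%:R); apply: cvgM; [exact: cvg_cst|exact: cvgr_inv_pinfty].
apply: (squeeze_cvgr _ (cvg_cst 0) c0); near=> r.
have r0 : 0 < r by near: r; exact: nbhs_pinfty_gt.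
rewrite gamma_weight_ge0 ?(ltW r0)//= /gamma_weight.
have := expR_ge1Dxn m (ltW r0).
have f0 : 0 < (m.+1`!)%:R :> R by rewrite ltr0n fact_gt0.
rewrite expRN => h.
rewrite ler_pdivlMr// mulrAC -exprSr ler_pdivrMr ?expR_gt0//.
rewrite -ler_pdivrMl// mulrC (le_trans _ h)// lerDr.
exact: ler01.
Unshelve. all: by end_near. Qed.

Lemma cvgr0_mul_bounded (f g : R -> R) : f r @[r --> +oo] --> (0 : R) ->
  (forall r, `|g r| <= 1) -> f r * g r @[r --> +oo] --> (0 : R).
Proof.
move=> f0 g1; apply/norm_cvg0P; apply: (squeeze_cvgr _ (cvg_cst 0) (_ : `|f r| @[r --> +oo] --> 0)).
  by apply: nearW => r; rewrite normr_ge0/= normrM ler_piMr.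
exact/norm_cvg0P.
Qed.

(** [A + iB] is the primitive of r^m e^(-(1-is)r) that vanishes at infinity, so minus its value at 0
    is the integral over the half-line. The induction on [m] is integration by parts. *)
Lemma gamma_primitive m s : exists A B : R -> R, [/\
   forall r, is_derive r 1 A (gamma_weight m r * cos (s * r)),
   forall r, is_derive r 1 B (gamma_weight m r * sin (s * r)),
   A r @[r --> +oo] --> (0 : R), B r @[r --> +oo] --> (0 : R) &
   (A 0 +i* B 0)%C = - (m`!%:R * ((1 - 'i * s%:C) ^- m.+1))%C :> R[i]].
Proof.
pose E r := expR (- r); pose C r := cos (s * r); pose S r := sin (s * r).
pose p : R := (1 + s ^+ 2)^-1; pose q : R := s / (1 + s ^+ 2).
have s21 : 1 + s ^+ 2 != 0 by rewrite lt0r_neq0// ltr_pwDl// sqr_ge0.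
have bE : ((1 - 'i * s%:C)^-1 = (p +i* q) :> R[i])%C.
  have bb : ((1 - 'i * s%:C) * (p +i* q) = 1 :> R[i])%C.
    rewrite /p /q; apply/eqP; rewrite eq_complex /=; apply/andP.
    by split; apply/eqP; field.
  have b0 : (1 - 'i * s%:C != 0 :> R[i])%C.
    by apply: contra_eq_neq bb => ->; rewrite mul0r eq_sym oner_neq0.
  by apply: (mulfI b0); rewrite bb divff.
have dE r : is_derive r 1 E (- E r).
  by apply: is_derive_eq; rewrite /E /GRing.scale/=; ring.
have dC r : is_derive r 1 C (- s * S r).
  by apply: is_derive_eq; rewrite /S /GRing.scale/=; ring.
have dS r : is_derive r 1 S (s * C r).
  by apply: is_derive_eq; rewrite /C /GRing.scale/=; ring.
have E0 : E r @[r --> +oo] --> (0 : R) by exact: cvgr_expR.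
elim: m => [|m [A [B [dA dB A0 B0 AB]]]].
  exists (fun r => - (p * (E r * C r) - q * (E r * S r))).
  exists (fun r => - (p * (E r * S r) + q * (E r * C r))).
  split.
  - move=> r; apply: is_derive_eq; rewrite /gamma_weight /p /q /GRing.scale/= -/(E r) -/(C r).
    by field.
  - move=> r; apply: is_derive_eq; rewrite /gamma_weight /p /q /GRing.scale/= -/(E r) -/(S r).
    by field.
  - have -> : 0 = - (p * 0 - q * 0) :> R by ring.
    by apply: cvgN; apply: cvgB; apply: cvgZr; apply: cvgr0_mul_bounded => // r;
      rewrite ?sin_max ?cos_max.
  - have -> : 0 = - (p * 0 + q * 0) :> R by ring.
    by apply: cvgN; apply: cvgD; apply: cvgZr; apply: cvgr0_mul_bounded => // r;
      rewrite ?sin_max ?cos_max.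
  - rewrite fact0 mul1r expr1 bE /E /C /S oppr0 mulr0 expR0 cos0 sin0.
    by apply/eqP; rewrite eq_complex/=; apply/andP; split; apply/eqP; ring.
pose w r := gamma_weight m.+1 r.
(* With [p + iq = 1 / (1 - is)], integration by parts reads F_(m+1) = -(p + iq) w e^(isr) + (m+1) (p
   + iq) F_m, here split into real and imaginary parts. *)
exists (fun r => - (p * (w r * C r) - q * (w r * S r)) + m.+1%:R * (p * A r - q * B r)).
exists (fun r => - (p * (w r * S r) + q * (w r * C r)) + m.+1%:R * (p * B r + q * A r)).
have dw r : is_derive r 1 w (m.+1%:R * gamma_weight m r - w r).
  have dX : is_derive r 1 (fun r => r ^+ m.+1 : R) (m.+1%:R * r ^+ m).
    rewrite (_ : (fun r => _) = (id : R -> R) ^+ m.+1); last first.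
      by apply/funext => x; rewrite exprfctE.
    by apply: is_derive_eq; rewrite /GRing.scale/= mulr1.
  rewrite /w /gamma_weight; apply: is_derive_eq.
  by rewrite /GRing.scale/= -/(E r); ring.
have wE r : gamma_weight m.+1 r = w r by [].
have w0 : w r @[r --> +oo] --> 0 by exact: gamma_weight_cvgy.
have w00 : w 0 = 0 by rewrite /w /gamma_weight expr0n mul0r.
have CE r : cos (s * r) = C r by [].
have SE r : sin (s * r) = S r by [].
have wC : w r * C r @[r --> +oo] --> 0 by apply: cvgr0_mul_bounded => // r; rewrite cos_max.
have wS : w r * S r @[r --> +oo] --> 0 by apply: cvgr0_mul_bounded => // r; rewrite sin_max.
clearbody w C S E.
split.
- move=> r; apply: is_derive_eq; rewrite /p /q /GRing.scale/= wE CE SE.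
  by field.
- move=> r; apply: is_derive_eq; rewrite /p /q /GRing.scale/= wE CE SE.
  by field.
- have -> : 0 = - (p * 0 - q * 0) + m.+1%:R * (p * 0 - q * 0) :> R by ring.
  apply: cvgD; last by apply: cvgZr; apply: cvgB; apply: cvgZr.
  by apply: cvgN; apply: cvgB; apply: cvgZr.
- have -> : 0 = - (p * 0 + q * 0) + m.+1%:R * (p * 0 + q * 0) :> R by ring.
  apply: cvgD; last by apply: cvgZr; apply: cvgD; apply: cvgZr.
  by apply: cvgN; apply: cvgD; apply: cvgZr.
- rewrite factS natrM exprS invfM bE w00.
  have -> : - (m.+1%:R * m`!%:R * ((p +i* q)%C / (1 - 'i * s%:C%C) ^+ m.+1)) =
      m.+1%:R * (p +i* q)%C * (- (m`!%:R / (1 - 'i * s%:C%C) ^+ m.+1)) by ring.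
  rewrite -AB.
  have -> : m.+1%:R = (m.+1%:R)%:C%C :> R[i] by rewrite rmorph_nat.
  by apply/eqP; rewrite eq_complex/=; apply/andP; split; apply/eqP; ring.
Qed.

Let mu := @lebesgue_measure R.

Lemma half_line_FTC (f F : R -> R) : (forall r, 0 <= r -> 0 <= f r) ->
  continuous f -> (forall r, is_derive r 1 F (f r)) ->
  F r @[r --> +oo] --> (0 : R) ->
  (\int[mu]_(r in `[0%R, +oo[) (f r)%:E = (- F 0)%:E)%E.
Proof.
move=> f0 cf dF Fy.
rewrite (ge0_continuous_FTC2y f0 _ Fy) ?sub0e//.
- exact: continuous_subspaceT.
- apply: cvg_at_right_filter; apply: differentiable_continuous.
  by apply/derivable1_diffP; have [] := dF 0.
- by move=> r _; rewrite derive1E; have [_ ->] := dF r.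
Qed.

Lemma integral_gamma_weight m :
  (\int[mu]_(r in `[0%R, +oo[) (gamma_weight m r)%:E = (m`!%:R)%:E)%E.
Proof.
have [A [B [dA _ A0 _ AB]]] := gamma_primitive m 0.
have dA' r : is_derive r 1 A (gamma_weight m r).
  by have := dA r; rewrite mul0r cos0 mulr1.
rewrite (half_line_FTC (@gamma_weight_ge0 m) (@continuous_gamma_weight m) dA' A0).
move: AB; rewrite mulr0 subr0 expr1n invr1 mulr1.
have -> : m`!%:R = (m`!%:R)%:C%C :> R[i] by rewrite rmorph_nat.
by move=> /eqP; rewrite eq_complex/= => /andP[/eqP -> _]; rewrite opprK.
Qed.

Lemma integrable_gamma_weight m :
  mu.-integrable `[0, +oo[ (EFin \o gamma_weight m).
Proof.
apply/integrableP; split.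
  apply/measurable_EFinP; apply: measurable_funTS.
  exact: continuous_measurable_fun (@continuous_gamma_weight m).
under eq_integral => r.
  rewrite inE/= in_itv/= andbT => r0.
  rewrite /= ger0_norm ?gamma_weight_ge0//; over.
by rewrite integral_gamma_weight ltry.
Qed.

Lemma integrable_gamma_weightM m (f : R -> R) : measurable_fun setT f ->
  (forall r, `|f r| <= 1) ->
  mu.-integrable `[0, +oo[ (fun r => (gamma_weight m r * f r)%:E).
Proof.
move=> mf f1; apply: (le_integrable _ _ _ (integrable_gamma_weight m)) => //.
  apply/measurable_EFinP; apply: measurable_funTS; apply: measurable_funM => //.
  exact: continuous_measurable_fun (@continuous_gamma_weight m).
move=> r /=; rewrite in_itv/= andbT => r0.
by rewrite lee_fin normrM ler_piMr.
Qed.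

Definition gamma_kernel m s : R :=
  \int[mu]_(r in `[0%R, +oo[) (gamma_weight m r * cos (s * r)).

Lemma gamma_kernelE m s :
  gamma_kernel m s = m`!%:R * complex.Re ((1 - 'i * s%:C) ^- m.+1)%C.
Proof.
have cC : continuous (fun r => cos (s * r) : R).
  move=> r; apply: continuous_comp; last exact: continuous_cos.
  by apply: cvgM; [exact: cvg_cst|exact: cvg_id].
have [A [B [dA _ A0 _ AB]]] := gamma_primitive m s.
have [A' [B' [dA' _ A'0 _ A'B']]] := gamma_primitive m 0.
have iC := @integrable_gamma_weightM m _ (continuous_measurable_fun cC) (fun r => cos_max _).
have Re0 (z t : R[i]) : z = - (m`!%:R * t) -> complex.Re z = - (m`!%:R * complex.Re t).
  have -> : m`!%:R = (m`!%:R)%:C%C :> R[i] by rewrite rmorph_nat.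
  by case: z t => z1 z2 [t1 t2] [-> _] /=; ring.
have /= A0E := Re0 _ _ AB.
have /= A'0E := Re0 _ _ A'B'.
(* [half_line_FTC] asks for a nonnegative integrand, so the weight itself (the case [s = 0]) is
   added to form [w (1 + cos)]; its integral m! cancels at the end. *)
have : Rintegral mu `[0, +oo[
    (fun r => gamma_weight m r + gamma_weight m r * cos (s * r)) = - (A' 0 + A 0).
  have dAA r : is_derive r 1 (A' + A) (gamma_weight m r + gamma_weight m r * cos (s * r)).
    by apply: is_derive_eq; rewrite mul0r cos0 mulr1.
  rewrite /Rintegral (half_line_FTC _ _ dAA)//.
  - move=> r r0; rewrite -[X in X + _]mulr1 -mulrDr mulr_ge0 ?gamma_weight_ge0//.
  - move=> r; apply: cvgD; first exact: continuous_gamma_weight.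
    by apply: cvgM; [exact: continuous_gamma_weight|exact: cC].
  - by rewrite -[X in _ --> X](addr0 (0 : R)); apply: cvgD.
rewrite RintegralD//=; last exact: integrable_gamma_weight.
rewrite {1}/Rintegral integral_gamma_weight/= A0E A'0E.
rewrite mulr0 subr0 expr1n invr1/= /gamma_kernel => h.
apply: (@addrI _ m`!%:R); rewrite h; ring.
Qed.

(** Multiplying by [1 - iu] changes each component by [u] times the other, so [M] becomes [2M + 1];
    the imaginary part is bounded for the sake of the induction. *)
Lemma Re_expr_near1 n : exists2 M : R, 0 <= M & forall u : R, 0 <= u <= 1 ->
  `|complex.Re ((1 - 'i * u%:C) ^+ n : R[i])%C - 1| <= M * u /\ `|complex.Im ((1 - 'i * u%:C) ^+ n : R[i])%C| <= M * u.
Proof.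
elim: n => [|n [M M0 IH]].
  by exists 0 => // u _; rewrite expr0/= subrr normr0 mul0r.
exists (M + M + 1) => [|u u01]; first lra.
have [] := IH _ u01; have /andP[u0 u1] := u01.
rewrite exprS; move: (_ ^+ n) => [x y] /=.
rewrite !ler_norml => /andP[x1 x2] /andP[y1 y2].
have -> : (M + M + 1) * u = M * u + M * u + u by ring.
have := mulr_ge0 M0 u0; move: (M * u) => t in x1 x2 y1 y2 * => t0.
have uy1 : - t <= u * y by nra.
have uy2 : u * y <= t by nra.
have ux1 : - t + u <= u * x by nra.
have ux2 : u * x <= t + u by nra.
by split; apply/andP; split; lra.
Qed.

(* Since 1 / (1 - is) = s / (1 + s^2) * i * (1 - i/s) and i^(m+1) = 1, the real part
   of the (m+1)-st power is close to (s / (1 + s^2))^(m+1) for large s. *)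
Lemma gamma_kernel_lb m : (4 %| m.+1)%N -> exists2 L, 1 <= L &
  forall s, L <= s -> m`!%:R * (2^-1 * (2 * s) ^- m.+1) <= gamma_kernel m s.
Proof.
move=> /dvdnP[q mq]; have [M M0 hM] := Re_expr_near1 m.+1.
(* For [s >= 2M + 1] the error [M / s] is at most 1/2, so the real part stays above 1/2; [s >= 1]
   gives [s / (1 + s^2) >= 1 / (2s)]. *)
exists (2 * M + 1) => [|s Ls]; first lra.
have s1 : 1 <= s by lra.
have s0 : 0 < s by lra.
rewrite gamma_kernelE ler_wpM2l ?ler0n//.
have -> : ((1 - 'i * s%:C) ^- m.+1 =
    ((s / (1 + s ^+ 2)) ^+ m.+1)%:C * (1 - 'i * (s^-1)%:C) ^+ m.+1 :> R[i])%C.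
  have i4 : 'i%C ^+ m.+1 = 1 :> R[i] by rewrite mq mulnC exprM -[4%N]/(2 * 2)%N exprM sqr_i sqrrN expr1n expr1n.
  set z : R[i] := (1 - 'i * s%:C)%C; set z' : R[i] := (1 - 'i * (s^-1)%:C)%C.
  rewrite -[RHS]mul1r -i4 rmorphXn -!exprMn -exprVn; congr (_ ^+ _); rewrite {}/z {}/z'.
  have z0 : (1 - 'i * s%:C != 0 :> R[i])%C.
    by rewrite eq_complex/=; apply/negP => /andP[/eqP + _]; lra.
  apply: (mulIf z0); rewrite mulVf//.
  have s2 : 1 + s ^+ 2 != 0 by rewrite lt0r_neq0// ltr_pwDl// sqr_ge0.
  by apply/eqP; rewrite eq_complex/=; apply/andP; split; apply/eqP; field;
    rewrite ?s2 ?lt0r_neq0.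
have -> (a : R) (z : R[i]) : complex.Re (a%:C%C * z) = a * complex.Re z.
  by case: z => x y /=; rewrite mul0r subr0.
have u01 : 0 <= s^-1 <= 1 by rewrite invr_ge0 ltW//= invf_le1.
have [] := hM _ u01; rewrite ler_norml => /andP[+ _] _.
have : M * s^-1 <= 2^-1 by rewrite ler_pdivrMr//; lra.
move: (complex.Re _) => x h1 h2.
have hx : 2^-1 <= x by lra.
have h0 : 0 <= (2 * s)^-1 by rewrite invr_ge0; lra.
have h : (2 * s)^-1 <= s / (1 + s ^+ 2).
  have s2 : 0 < 1 + s ^+ 2 by rewrite ltr_pwDl// sqr_ge0.
  by rewrite ler_pdivlMr// ler_pdivrMl; [nra|lra].
rewrite mulrC -exprVn ler_pM ?exprn_ge0//.
by rewrite lerXn2r ?nnegrE// (le_trans h0).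
Qed.

End gamma_kernel.

(** * Volume of the caps of a convex body *)

Section supporting_cap.
Context (R : realType).

(** The differential is bounded and the remainder is eventually at most [|h|]. Applied to the
    partial derivatives of a defining function, this controls its gradient near a boundary point. *)
Lemma differentiable_lipschitz_near (V : normedModType R) (f : V -> R) (p : V) :
  differentiable f p -> exists2 M : R, 0 <= M &
    \forall h \near (0 : V), `|f (p + h) - f p| <= M * `|h|.
Proof.
move=> fp; have [dc _] := (diff_locallyxP p f).1 fp.
have /linear_boundedP/pinfty_ex_gt0[M M0 hM] := (linear_bounded_continuous ('d f p)).2 dc.
have h1 := diff_locallyxC fp.
exists (M + 1); first by rewrite addr_ge0 ?ltW.
near=> h; rewrite h1 [f p + _]addrC addrAC addrK mulrDl.
rewrite (le_trans (ler_normD _ _))// lerD//.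
near: h; exact: littleoP.
Unshelve. all: by end_near. Qed.

Lemma dotvC d (x y : 'rV[R]_d) : dotv x y = dotv y x.
Proof. by apply: eq_bigr => i _; rewrite mulrC. Qed.

Lemma dotvD d (x y z : 'rV[R]_d) : dotv x (y + z) = dotv x y + dotv x z.
Proof. by rewrite /dotv -big_split; apply: eq_bigr => i _; rewrite mxE mulrDr. Qed.

Lemma dotvZ d (x y : 'rV[R]_d) (a : R) : dotv x (a *: y) = a * dotv x y.
Proof. by rewrite /dotv mulr_sumr; apply: eq_bigr => i _; rewrite mxE mulrCA. Qed.

Lemma dotvv_ge0 d (x : 'rV[R]_d) : 0 <= dotv x x.
Proof. by apply: sumr_ge0 => i _; rewrite -expr2 sqr_ge0. Qed.

Lemma dotvv_eq0 d (x : 'rV[R]_d) : dotv x x = 0 -> x = 0.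
Proof.
move=> /eqP; rewrite psumr_eq0 => [/allP x0|i _]; last by rewrite -expr2 sqr_ge0.
apply/rowP => i; have := x0 i (mem_index_enum _).
by rewrite -expr2 sqrf_eq0 mxE => /eqP.
Qed.

(** Write [x = c n + w] with [w] orthogonal to [n]. Testing [v = - w - tau n] gives
    [(w, w) <= - tau (x, n)] for every [tau > 0], hence [w = 0]; testing [v = - n], with [x != 0],
    gives [c < 0]. *)
Lemma half_space_normal d (x n : 'rV[R]_d) : x != 0 -> n != 0 ->
  (forall v, dotv n v < 0 -> 0 <= dotv x v) ->
  exists2 k, 0 < k & n = - k *: x.
Proof.
move=> x0 n0 hv.
have nn : 0 < dotv n n.
  by rewrite lt_neqAle dotvv_ge0 andbT eq_sym; apply: contraNneq n0 => /dotvv_eq0 ->.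
pose c := dotv x n / dotv n n; pose w := x - c *: n.
have nw : dotv n w = 0.
  by rewrite /w -scaleNr dotvD dotvZ /c [dotv n x]dotvC; field; rewrite lt0r_neq0.
have xw : dotv x w = dotv w w.
  have -> : dotv w w = dotv w x - c * dotv w n.
    by rewrite {2}/w -scaleNr dotvD dotvZ mulNr.
  by rewrite [dotv w n]dotvC nw mulr0 subr0 dotvC.
have w0 : w = 0.
  apply: dotvv_eq0; apply: le_anti; rewrite dotvv_ge0 andbT.
  apply/ler_addgt0Pr => e e0; rewrite add0r.
  pose tau := e / (1 + `|dotv x n|).
  have q0 : 0 < 1 + `|dotv x n| by rewrite ltr_pwDl.
  have tau0 : 0 < tau by rewrite divr_gt0.
  have h : dotv w w <= - (tau * dotv x n).
    move: (w) nw xw => w1 nw1 <-.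
    have := hv (- 1 *: w1 + - tau *: n); rewrite !dotvD !dotvZ nw1 mulr0 add0r mulNr oppr_lt0.
    by rewrite mulr_gt0// => /(_ isT); rewrite mulN1r mulNr addrC subr_ge0; lra.
  have : tau * `|dotv x n| <= e.
    by rewrite /tau mulrAC ler_pdivrMr// ler_pM2l// lerDr.
  have : - (tau * dotv x n) <= tau * `|dotv x n|.
    by rewrite -mulrN ler_pM2l// -normrN ler_norm.
  by lra.
have xE : x = c *: n by apply/eqP; rewrite -subr_eq0 -/w w0.
have c0 : c < 0.
  have := hv (- 1 *: n); rewrite !dotvZ !mulN1r oppr_lt0 nn => /(_ isT).
  rewrite oppr_ge0 => xn; rewrite lt_neqAle; apply/andP; split.
    by apply: contraNneq x0 => c0; rewrite xE c0 scale0r.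
  by rewrite pmulr_lle0// invr_gt0.
exists (- c^-1); first by rewrite oppr_gt0 invr_lt0.
by rewrite opprK {1}xE scalerA mulVf ?scale1r// lt_eqF.
Qed.

Lemma norm_coord_le d (v : 'rV[R]_d) i : `|v ord0 i| <= `|v|.
Proof.
rewrite [leRHS]/Num.norm/= mx_normrE.
exact: (le_bigmax _ (fun ij : 'I_1 * 'I_d => `|v ij.1 ij.2|) (ord0, i)).
Qed.

Lemma norm_rV_le d (v : 'rV[R]_d) (a : R) : 0 <= a ->
  (forall i, `|v ord0 i| <= a) -> `|v| <= a.
Proof.
move=> a0 va; rewrite [leLHS]/Num.norm/= mx_normrE.
by apply/bigmax_leP; split => // -[i j] _; rewrite (ord1 i).
Qed.

Lemma derive_grad d (f : 'rV[R]_d -> R) y v : differentiable f y ->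
  'D_v f y = dotv (grad f y) v.
Proof.
move=> fy; rewrite deriveE// [in LHS](row_sum_delta v) linear_sum.
by apply: eq_bigr => i _; rewrite linearZ mxE -deriveE// mulrC.
Qed.

Lemma is_derive_line (V : normedModType R) (f : V -> R) (p v : V) (tau : R) :
  derivable f (p + tau *: v) v ->
  is_derive tau 1 (fun t => f (p + t *: v)) ('D_v f (p + tau *: v)).
Proof.
have E : (fun h : R => h^-1 *: (((fun t => f (p + t *: v)) \o shift tau) (h *: 1) -
      f (p + tau *: v))) =
    (fun h => h^-1 *: ((f \o shift (p + tau *: v)) (h *: v) - f (p + tau *: v))).
  apply/funext => h /=; congr (_ *: (f _ - _)).
  by rewrite [h *: 1]mulr1 scalerDl addrCA.
by move=> df; split; rewrite /derivable /derive E.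
Qed.

(** By the mean value theorem [rho (p + v) - rho p] is [(grad rho (p + c v), v)] for some [c]
    between 0 and 1. As [rho] is C^2, this differs from [(grad rho p, v)] by at most [M |v|^2]. *)
Lemma sublevel_paraboloid d k (K : set 'rV[R]_d) p V rho :
  defining_function k.+2 K p V rho -> K p ->
  exists M delta : R, [/\ 0 <= M, 0 < delta &
    forall v, `|v| < delta -> dotv (grad rho p) v + M * `|v| ^+ 2 <= 0 -> K (p + v)].
Proof.
move=> [oV Vp [drho d2rho] _ KV] Kp.
have /choice[M hM] (i : 'I_d) : exists M : R, 0 <= M /\
    \forall h \near (0 : 'rV[R]_d),
      `|grad rho (p + h) ord0 i - grad rho p ord0 i| <= M * `|h|.
  have [dD _] := d2rho (delta_mx ord0 i).
  have [M M0 hM] := differentiable_lipschitz_near (dD _ Vp).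
  by exists M; split => //; apply: filterS hM => h; rewrite !mxE.
have nV : \forall h \near (0 : 'rV[R]_d), V (p + h).
  have /nbhs_ballP[r /= r0 hr] : nbhs p V by exact: open_nbhs_nbhs.
  apply/nbhs_ballP; exists r => // h; rewrite -ball_normE/= sub0r normrN => hh.
  by apply: hr; rewrite -ball_normE/= opprD addNKr normrN.
have nM : \forall h \near (0 : 'rV[R]_d), forall i,
    `|grad rho (p + h) ord0 i - grad rho p ord0 i| <= M i * `|h|.
  pose P i := [set h | `|grad rho (p + h) ord0 i - grad rho p ord0 i| <= M i * `|h|].
  exact: (@filter_forall _ _ P _ _ (fun i => (hM i).2)).
have /nbhs_ballP[delta /= delta0 hd] : nbhs (0 : 'rV[R]_d) [set h | V (p + h) /\ forall i,
    `|grad rho (p + h) ord0 i - grad rho p ord0 i| <= M i * `|h|] by exact: filterI.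
(* [|v|] is the maximum norm: coordinate [i] contributes an error of at most [M i * |v|^2], and the
   constants add up. *)
exists (\sum_i M i), delta; split => //; first by apply: sumr_ge0 => i _; exact: (hM i).1.
move=> v vd hv.
have hball (t : R) : 0 <= t <= 1 -> ball (0 : 'rV[R]_d) delta (t *: v).
  move=> /andP[t0 t1]; rewrite -ball_normE/= sub0r normrN normrZ ger0_norm//.
  by rewrite (le_lt_trans _ vd)// ler_piMl.
have der (t : R) : 0 <= t <= 1 ->
    is_derive t 1 (fun t => rho (p + t *: v)) (dotv (grad rho (p + t *: v)) v).
  move=> t01; have [Vt _] := hd _ (hball _ t01); rewrite -derive_grad; last exact: drho.
  by apply: is_derive_line; apply: diff_derivable; exact: drho.
have [|||c] := @MVT _ (fun t => rho (p + t *: v)) (fun t => dotv (grad rho (p + t *: v)) v) 0 1.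
- exact: ltr01.
- by move=> t; rewrite in_itv/= => /andP[t0 t1]; apply: der; rewrite !ltW.
- apply: derivable_within_continuous => t; rewrite in_itv/= => t01.
  by have [] := der _ t01.
rewrite in_itv/= => /andP[c0 c1]; rewrite scale0r addr0 subr0 mulr1 scale1r => E.
have c01 : 0 <= c <= 1 by rewrite !ltW.
have o01 : 0 <= (1 : R) <= 1 by rewrite ler01 lexx.
have [V1 _] := hd _ (hball _ o01); rewrite scale1r in V1.
apply/(KV _ V1); have : rho p <= 0 by apply/(KV _ Vp).
suff : dotv (grad rho (p + c *: v)) v <= dotv (grad rho p) v + (\sum_i M i) * `|v| ^+ 2.
  by lra.
rewrite /dotv mulr_suml -big_split/=; apply: ler_sum => i _.
rewrite -lerBlDl -mulrBl (le_trans (ler_norm _))// normrM expr2 mulrA.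
have [_ hc] := hd _ (hball _ c01).
apply: ler_pM => //; last exact: norm_coord_le.
apply: le_trans (hc i) _; apply: ler_wpM2l; first exact: (hM i).1.
by rewrite normrZ ger0_norm ?(ltW c0)// ler_piMl// ltW.
Qed.

End supporting_cap.

(** * Volume of a box sheared along one coordinate *)

Section sheared_box.
Context (R : realType).

Lemma measurable_dotv n (t : 'rV[R]_n) : measurable_fun setT (dotv t).
Proof.
apply: measurable_sum => i; apply: measurable_funM => //.
exact: measurable_coord.
Qed.

(* The coordinate p_i plays no role: v_i is determined, up to an interval of length
   e / |l_i|, by the other coordinates and the slab condition. *)
Definition sheared_box n (i : 'I_n) (l p : 'rV[R]_n) (a b e : R) : set 'rV[R]_n :=
  [set v : 'rV[R]_n | (forall j, j != i -> p ord0 j - a <= v ord0 j <= p ord0 j + a) /\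
           b <= dotv l v <= b + e].

Lemma measurable_sheared_box n (i : 'I_n) (l p : 'rV[R]_n) (a b e : R) :
  measurable (sheared_box i l p a b e).
Proof.
have -> : sheared_box i l p a b e =
    (\bigcap_(j in [set j | j != i])
      (fun v : 'rV[R]_n => v ord0 j : R) @^-1` `[p ord0 j - a, p ord0 j + a]) `&`
    dotv l @^-1` `[b, b + e].
  apply/seteqP; split => v /= [vp vl].
    by split=> [j /= /vp|]; rewrite in_itv.
  split=> [j /vp|]; first by rewrite /= in_itv.
  by move: vl; rewrite in_itv.
apply: measurableI.
  apply: fin_bigcap_measurable => [|j _]; first exact: finite_finset.
  by rewrite -[X in measurable X]setTI; apply: measurable_coord.
by rewrite -[X in measurable X]setTI; exact: measurable_dotv.
Qed.

Lemma lebesgue_measure_segment (a b : R) : a <= b ->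
  lebesgue_measure `[a, b]%classic = (b - a)%:E.
Proof.
rewrite le_eqVlt => /predU1P[->|ab]; rewrite lebesgue_measure_itv/= lte_fin.
  by rewrite ltxx subrr.
by rewrite ab.
Qed.

Lemma lebesgue_measure_slab (l b e : R) : l != 0 -> 0 <= e ->
  lebesgue_measure [set x : R | b <= l * x <= b + e] = (e / `|l|)%:E.
Proof.
move=> l0 e0.
have [lt0|gt0|//] := ltrgtP l 0; last by move=> l_eq0; rewrite l_eq0 eqxx in l0.
- have -> : [set x : R | b <= l * x <= b + e] = `[(b + e) / l, b / l]%classic.
    apply/seteqP; split => x /=; rewrite in_itv/= ler_ndivrMr// ler_ndivlMr// [x * l]mulrC andbC//.
  rewrite lebesgue_measure_segment; last by rewrite ler_ndivrMr// divfK// lerDl.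
  by rewrite ltr0_norm//; congr EFin; field.
- have -> : [set x : R | b <= l * x <= b + e] = `[b / l, (b + e) / l]%classic.
    apply/seteqP; split => x /=; rewrite in_itv/= ler_pdivrMr// ler_pdivlMr// [x * l]mulrC//.
  rewrite lebesgue_measure_segment; last by rewrite ler_pM2r ?invr_gt0// lerDl.
  by rewrite gtr0_norm//; congr EFin; field.
Qed.

Lemma dotv_cons n (l : 'rV[R]_n.+1) (q : R * 'rV[R]_n) :
  dotv l (cons_rV q) = l ord0 ord0 * q.1 + dotv (uncons_rV l).2 q.2.
Proof.
rewrite /dotv big_ord_recl cons_rV0; congr (_ + _).
by apply: eq_bigr => j _; rewrite cons_rVS mxE.
Qed.

(** Induction on the dimension, peeling off coordinate 0. If [i] is not 0, the slices at a fixed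
    coordinate 0 are sheared boxes with a shifted [b]; if [i] is 0, the slices at fixed other
    coordinates are intervals of length [e / |l_0|]. *)
Lemma lebesgue_sheared_box n (i : 'I_n) (l p : 'rV[R]_n) (a b e : R) :
  l ord0 i != 0 -> 0 <= a -> 0 <= e ->
  lebesgue_rV R n (sheared_box i l p a b e) =
  ((2 * a) ^+ n.-1 * (e / `|l ord0 i|))%:E.
Proof.
elim: n i l p b => [[]//|n IH] i l p b li a0 e0.
have mA : measurable (@cons_rV R n @^-1` sheared_box i l p a b e).
  rewrite -[X in measurable X]setTI; apply: measurable_cons_rV => //.
  exact: measurable_sheared_box.
rewrite /= /cons_measure /pushforward.
have [i' ii'|i0] := unliftP ord0 i.
- pose l' := (uncons_rV l).2; pose p' := (uncons_rV p).2.
  have l'i' : l' ord0 i' = l ord0 i by rewrite mxE ii'.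
  rewrite /product_measure1.
  transitivity (\int[lebesgue_measure]_(x in `[(p ord0 ord0 - a)%R, (p ord0 ord0 + a)%R])
      ((2 * a) ^+ n.-1 * (e / `|l ord0 i|))%:E)%E.
    rewrite [RHS]integral_mkcond; apply: eq_integral => x _; rewrite patchE /=.
    case: ifPn => [|/negP]; rewrite inE/= in_itv/= => xp.
      rewrite -l'i' -(IH i' l' p' (b - l ord0 ord0 * x)) ?l'i'//; congr (lebesgue_rV R n _).
      apply/seteqP; split => v /=; rewrite /xsection/= inE /sheared_box/= dotv_cons/= -/l'.
        move=> [vp vl]; split.
          by move=> j ji'; have := vp (lift ord0 j); rewrite cons_rVS ii' (inj_eq lift_inj) mxE; exact.
        by move: vl => /andP[? ?]; apply/andP; split; lra.
      move=> [vp vl]; split; last by move: vl => /andP[? ?]; apply/andP; split; lra.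
      move=> j; have [j' ->|->] := unliftP ord0 j; last by rewrite cons_rV0.
      by rewrite cons_rVS ii' (inj_eq lift_inj) => /vp; rewrite mxE.
    rewrite (_ : xsection _ _ = set0) ?measure0//.
    apply/seteqP; split => v //=; rewrite /xsection/= inE => -[/(_ ord0)].
    by rewrite ii' cons_rV0/= => /(_ isT).
  have n0 : (0 < n)%N by exact: leq_ltn_trans (ltn_ord i').
  rewrite integral_cst//= lebesgue_measure_segment; last lra.
  rewrite -EFinM; congr EFin.
  have -> : (2 * a) ^+ n = 2 * a * (2 * a) ^+ n.-1 by rewrite -exprS prednK.
  by move: (_ ^+ _) (e / _) => x y; ring.
- rewrite {}i0 in li mA *.
  pose p' := (uncons_rV p).2; pose l' := (uncons_rV l).2.
  (* The product measure is given by integrating over the first factor; uniqueness allows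
     integrating over the second one instead. *)
  rewrite (@product_measure_unique _ _ _ _ _ (@lebesgue_measure R) (lebesgue_rV R n)
    (@lebesgue_measure R \x^ lebesgue_rV R n)%E)//; last first.
    by move=> A B mA' mB; exact: product_measure2E.
  pose lo := p' - const_mx a; pose hi := p' + const_mx a.
  rewrite /= /product_measure2.
  transitivity (\int[lebesgue_rV R n]_(v in
      [set v : 'rV[R]_n | forall j, (lo ord0 j <= v ord0 j <= hi ord0 j)%R])
      (e / `|l ord0 ord0|)%:E)%E.
    rewrite [RHS]integral_mkcond; apply: eq_integral => v _; rewrite patchE /=.
    case: ifPn => [|/negP]; rewrite inE/= => vp.
      rewrite -(@lebesgue_measure_slab _ (b - dotv l' v))//; congr (lebesgue_measure _).
      apply/seteqP; split => x /=; rewrite /ysection/= inE /sheared_box/= dotv_cons/= -/l'.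
        by move=> [_ /andP[? ?]]; apply/andP; split; lra.
      move=> /andP[? ?]; split; last by apply/andP; split; lra.
      move=> j; have [j' -> _|->] := unliftP ord0 j; last by rewrite eqxx.
      by rewrite cons_rVS; have := vp j'; rewrite !mxE.
    rewrite (_ : ysection _ _ = set0) ?measure0//.
    apply/seteqP; split => x //=; rewrite /ysection/= inE => -[bx _].
    apply: vp => j; have := bx (lift ord0 j); rewrite cons_rVS !mxE.
    by apply; rewrite eq_sym neq_lift.
  have lohi j : lo ord0 j <= hi ord0 j by rewrite !mxE; lra.
  rewrite integral_cst; last exact: measurable_box_rV.
  transitivity ((e / `|l ord0 ord0|)%:E * (\prod_(j < n) (hi ord0 j - lo ord0 j))%:E)%E.
    by congr (_ * _)%E; exact: lebesgue_rV_box lohi.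
  rewrite -EFinM mulrC; congr EFin; congr (_ * _).
  rewrite (eq_bigr (fun=> 2 * a)) ?prodr_const ?card_ord// => j _.
  by rewrite !mxE; ring.
Qed.

End sheared_box.

Section cap_volume.
Context (R : realType) (d : nat).
Implicit Types (x y p n v : 'rV[R]_d) (K : set 'rV[R]_d).

Lemma measurable_compact_rV K : compact K -> measurable K.
Proof.
move=> cK; rewrite -[X in measurable X]setCK; apply: measurableC.
apply: open_measurable_rV; apply: closed_openC.
exact: compact_closed (@norm_hausdorff _ _) cK.
Qed.

Lemma dotv_continuous x : continuous (dotv x).
Proof.
apply: continuous_big => [|i _ y]; first exact: add_continuous.
by apply: continuousM; [exact: cst_continuous|exact: coord_continuous].
Qed.

(** If [(n, v) < 0], the linear term at [tau v] beats the quadratic one for small [tau], so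
    [p + tau v] lies in [K] and minimality at [p] gives [(x, v) >= 0]. *)
Lemma paraboloid_normal K p x n (M delta : R) : x != 0 -> n != 0 ->
  0 <= M -> 0 < delta ->
  (forall v, `|v| < delta -> dotv n v + M * `|v| ^+ 2 <= 0 -> K (p + v)) ->
  (forall y, K y -> dotv x p <= dotv x y) ->
  exists2 k, 0 < k & n = - k *: x.
Proof.
move=> x0 n0 M0 delta0 hK hmin; apply: half_space_normal => // v nv.
pose q := 1 + `|v|; have q0 : 0 < q by rewrite ltr_pwDl.
(* The first bound keeps [|tau v|] below [delta], the second keeps [tau M |v|^2] at most
   [- (n, v)]. *)
pose tau := Num.min (delta / (2 * q)) (- dotv n v / ((M + 1) * q ^+ 2)).
have M1 : 0 < M + 1 by rewrite ltr_wpDl.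
have tau0 : 0 < tau.
  rewrite lt_min !divr_gt0 ?mulr_gt0 ?exprn_gt0 ?oppr_gt0//.
have tq : tau * q <= delta / 2.
  rewrite -ler_pdivlMr// -mulrA -invfM.
  by rewrite ge_min lexx.
have tq2 : tau * ((M + 1) * q ^+ 2) <= - dotv n v.
  by rewrite -ler_pdivlMr ?mulr_gt0 ?exprn_gt0// ge_min lexx orbT.
have nt : `|tau *: v| = tau * `|v| by rewrite normrZ gtr0_norm.
have v0 : 0 <= `|v| by [].
have := hmin (p + tau *: v); rewrite dotvD dotvZ lerDl pmulr_rge0//; apply.
apply: hK; rewrite nt.
  have : tau * `|v| <= tau * q by rewrite ler_pM2l// /q lerDr.
  by lra.
rewrite dotvZ exprMn.
have -> : tau * dotv n v + M * (tau ^+ 2 * `|v| ^+ 2) =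
   tau * (dotv n v + tau * (M * `|v| ^+ 2)) by ring.
rewrite pmulr_rle0//.
have : tau * (M * `|v| ^+ 2) <= tau * ((M + 1) * q ^+ 2).
  rewrite ler_pM2l//; apply: ler_pM; rewrite ?sqr_ge0 ?lerDl//.
  by rewrite ler_pXn2r// ?nnegrE ?(ltW q0)// /q lerDr.
by lra.
Qed.

(** The cap contains a sheared box of width of order [e] in [d - 1] directions and thickness of
    order [e^2]. *)
Lemma paraboloid_cap_volume K p x (k M delta : R) : measurable K ->
  x != 0 -> 0 < k -> 0 <= M -> 0 < delta ->
  (forall v, `|v| < delta -> dotv (- k *: x) v + M * `|v| ^+ 2 <= 0 -> K (p + v)) ->
  exists c e0 : R, [/\ 0 < c, 0 < e0 & forall e, 0 < e <= e0 ->
    ((c * e ^+ d.+1)%:E <=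
     lebesgue_rV R d (K `&` [set y | (dotv x y <= dotv x p + e ^+ 2)%R]))%E].
Proof.
move=> mK x0 k0 M0 delta0 hK.
have /rV0Pn[i xi0] := x0.
have d0 : (0 < d)%N by exact: leq_ltn_trans (ltn_ord i).
have xi : 0 < `|x ord0 i| by rewrite normr_gt0.
pose X := \sum_j `|x ord0 j|.
have X0 : 0 <= X by exact: sumr_ge0.
(* Solving [(x, v)] for [v_i] gives [|v_i| <= c e (1 + X) / |x_i|] on the box once [e <= c], so
   [c e B] bounds [|v|]. *)
pose B := 1 + (1 + X) / `|x ord0 i|.
have B1 : 1 <= B by rewrite lerDl divr_ge0// addr_ge0.
have B0 : 0 < B by lra.
pose D := 2 * (M + 1) * B ^+ 2.
have D0 : 0 < D by rewrite !mulr_gt0 ?exprn_gt0//; lra.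
(* [c <= k / D] makes the quadratic term at most [k e^2 / 2]; [e0 <= delta / (2B)] keeps
   [|v| < delta]. *)
pose c := Num.min 1 (k / D); pose e0 := Num.min c (delta / (2 * B)).
have c0 : 0 < c by rewrite lt_min ltr01 divr_gt0.
have e00 : 0 < e0 by rewrite lt_min c0 divr_gt0// mulr_gt0.
have c1 : c <= 1 by rewrite ge_min lexx.
have cD : c * D <= k by rewrite -ler_pdivlMr// ge_min lexx orbT.
exists ((2 * c) ^+ d.-1 / (2 * `|x ord0 i|)), e0; split => //.
  by rewrite divr_gt0 ?exprn_gt0 ?mulr_gt0.
move=> e /andP[e_gt0 ee0].
have ec : e <= c by apply: le_trans ee0 _; rewrite ge_min lexx.
have eB : e * (2 * B) <= delta.
  by rewrite -ler_pdivlMr ?mulr_gt0//; apply: le_trans ee0 _; rewrite ge_min lexx orbT.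
have ce0 : 0 <= c * e by rewrite mulr_ge0// ltW.
have e20 : 0 <= e ^+ 2 / 2 by rewrite divr_ge0// sqr_ge0.
have -> : (2 * c) ^+ d.-1 / (2 * `|x ord0 i|) * e ^+ d.+1 =
    (2 * (c * e)) ^+ d.-1 * (e ^+ 2 / 2 / `|x ord0 i|).
  rewrite [2 * (c * e)]mulrA [in RHS]exprMn.
  have -> : e ^+ d.+1 = e ^+ d.-1 * e ^+ 2 by rewrite -exprD addn2 prednK.
  by move: (e ^+ d.-1) ((2 * c) ^+ d.-1) => a b; field; rewrite lt0r_neq0.
(* On the slab e^2/2 <= (x, y - p) <= e^2 the linear term is at most -k e^2/2, which
   beats the quadratic term on a box of radius c e in the other coordinates. *)
rewrite -(@lebesgue_sheared_box _ _ i x p (c * e) (dotv x p + e ^+ 2 / 2))//.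
apply: le_measure; rewrite ?inE.
- exact: measurable_sheared_box.
- apply: measurableI => //; rewrite -[X in measurable X]setTI.
  rewrite (_ : [set _ | _] = dotv x @^-1` `]-oo, dotv x p + e ^+ 2]); last first.
    by apply/seteqP; split => y /=; rewrite in_itv.
  exact: measurable_dotv.
move=> y [/= yp /andP[y1 y2]]; split; last by rewrite /=; lra.
pose v := y - p; have yE : y = p + v by rewrite addrCA subrr addr0.
rewrite yE; rewrite yE dotvD in y1 y2.
have vj j : j != i -> `|v ord0 j| <= c * e.
  by move=> /yp; rewrite /v !mxE ler_norml => /andP[? ?]; apply/andP; split; lra.
have vi : `|v ord0 i| <= c * e * B.
  have : `|x ord0 i| * `|v ord0 i| <= c * e * (1 + X).
    rewrite -normrM.
    have -> : x ord0 i * v ord0 i = dotv x v - \sum_(j | j != i) x ord0 j * v ord0 j.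
      by rewrite /dotv (bigD1 i)//= addrK.
    rewrite (le_trans (ler_normB _ _))// mulrDr mulr1 lerD//.
      rewrite ger0_norm; last by lra.
      by apply: (@le_trans _ _ (e * e)); [lra|rewrite ler_pM2r].
    rewrite (le_trans (ler_norm_sum _ _ _))// /X mulr_sumr.
    apply: (@le_trans _ _ (\sum_(j | j != i) c * e * `|x ord0 j|)).
      by apply: ler_sum => j ji; rewrite normrM mulrC ler_wpM2r ?vj.
    by rewrite [X in _ <= X](bigD1 i)//= lerDr mulr_ge0.
  rewrite mulrC -ler_pdivlMr// => /le_trans; apply.
  by rewrite -(mulrA (c * e)) (ler_wpM2l ce0)// /B lerDr.
have vB : `|v| <= c * e * B.
  apply: norm_rV_le => [|j]; first by rewrite mulr_ge0// ltW.
  have [->//|ji] := eqVneq j i.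
  by rewrite (le_trans (vj _ ji))// ler_peMr.
apply: hK.
  have : c * e * B <= e * B by rewrite ler_pM2r// ler_piMl// ltW.
  have : 0 < e * B by rewrite mulr_gt0.
  by lra.
rewrite dotvC dotvZ mulNr dotvC.
have vB2 : M * `|v| ^+ 2 <= (M + 1) * (c * e * B) ^+ 2.
  rewrite ler_pM ?sqr_ge0 ?lerDl// ler_pXn2r ?nnegrE//.
  by rewrite mulr_ge0// ltW.
have cD2 : (M + 1) * (c * e * B) ^+ 2 <= k * (e ^+ 2 / 2).
  have -> : (M + 1) * (c * e * B) ^+ 2 = c * (c * D) * (e ^+ 2 / 2) by rewrite /D; field.
  rewrite ler_wpM2r// (le_trans _ cD)// ler_piMl// mulr_ge0// ltW//.
have : k * (e ^+ 2 / 2) <= k * dotv x v by rewrite ler_pM2l//; lra.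
by lra.
Qed.

End cap_volume.

(** * Caps at the minimizers of a linear form *)

Section convex_body_cap.
Context (R : realType) (d : nat).
Implicit Types (x y p v : 'rV[R]_d) (K : set 'rV[R]_d).

Lemma linear_minimizer K x : compact K -> K !=set0 ->
  exists2 p, K p & forall y, K y -> dotv x p <= dotv x y.
Proof.
move=> cK K0; have cx : {within K, continuous (dotv x)}.
  exact/continuous_subspaceT/dotv_continuous.
have [p] := @compact_EVT_min _ R (dotv x) K K0 cK cx.
by rewrite inE => Kp hp; exists p => // y Ky; apply: hp; rewrite inE.
Qed.

Lemma minimizer_boundary K x p : x != 0 -> K p ->
  (forall y, K y -> dotv x p <= dotv x y) -> boundary K p.
Proof.
move=> x0 Kp hmin; split; first exact: subset_closure.
rewrite /interior/= => /nbhs_ballP[r /= r0 hr].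
pose t := r / (2 * `|x|).
have nx : 0 < `|x| by rewrite normr_gt0.
have t0 : 0 < t by rewrite divr_gt0// mulr_gt0.
have := hmin (p + - t *: x).
have xx : 0 < dotv x x.
  rewrite lt_neqAle dotvv_ge0 andbT eq_sym.
  by apply: contraNneq x0 => /dotvv_eq0 ->.
rewrite dotvD dotvZ lerDl mulNr oppr_ge0 => h.
have : t * dotv x x <= 0.
  apply: h; apply: hr; rewrite -ball_normE/= opprD addNKr normrN normrZ normrN.
  rewrite gtr0_norm// /t invfM mulrA mulfVK ?lt0r_neq0//; lra.
by rewrite leNgt mulr_gt0.
Qed.

Lemma smooth_cap_volume K k x p : compact K -> x != 0 -> boundary_class k.+2 K ->
  K p -> (forall y, K y -> dotv x p <= dotv x y) ->
  exists c e0 : R, [/\ 0 < c, 0 < e0 & forall e, 0 < e <= e0 ->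
    ((c * e ^+ d.+1)%:E <=
     lebesgue_rV R d (K `&` [set y | (dotv x y <= dotv x p + e ^+ 2)%R]))%E].
Proof.
move=> cK x0 bK Kp hmin.
have [V [rho rhoP]] := bK _ (minimizer_boundary x0 Kp hmin).
have [M [delta [M0 delta0 hK]]] := sublevel_paraboloid rhoP Kp.
have n0 : grad rho p != 0 by case: rhoP => _ Vp _ /(_ _ Vp).
have [l l0 nE] := paraboloid_normal x0 n0 M0 delta0 hK hmin.
rewrite nE in hK; apply: (paraboloid_cap_volume _ x0 l0 M0 delta0) => //.
exact: measurable_compact_rV.
Qed.

Lemma lebesgue_rV_set1 p : (0 < d)%N -> lebesgue_rV R d [set p] = 0%E.
Proof.
move=> d0; have -> : [set p] = [set y | forall i, p ord0 i <= y ord0 i <= p ord0 i].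
  apply/seteqP; split => [y -> i|y /= yp]; first by rewrite lexx.
  by apply/rowP => i; apply/esym/le_anti.
rewrite lebesgue_rV_box// (bigD1 (Ordinal d0))//= subrr mul0r//.
Qed.

(** A point is null, so [K] contains some [q] with [(x, q) > (x, p)] and, by convexity, the segment
    from [p] to [q]. The cap thus contains an interval of length [e^2 / |x_i|] as soon as
    [e^2 <= D]. *)
Lemma segment_cap_volume K x p : d = 1%N -> convex_set K -> compact K ->
  (0 < lebesgue_rV R d K)%E -> x != 0 ->
  K p -> (forall y, K y -> dotv x p <= dotv x y) ->
  exists c e0 : R, [/\ 0 < c, 0 < e0 & forall e, 0 < e <= e0 ->
    ((c * e ^+ d.+1)%:E <=
     lebesgue_rV R d (K `&` [set y | (dotv x y <= dotv x p + e ^+ 2)%R]))%E].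
Proof.
move=> d1 cvK cK K0 x0 Kp hmin.
have mK := measurable_compact_rV cK.
have /rV0Pn[i xi0] := x0.
have iE j : j = i.
  by apply: val_inj; case: i j {xi0} => i + [j]; rewrite /= d1; case: i => //; case: j.
have dE y : dotv x y = x ord0 i * y ord0 i.
  by rewrite /dotv (bigD1 i)//= big1 ?addr0// => j; rewrite (iE j) eqxx.
have xy_inj y z : dotv x y = dotv x z -> y = z.
  by rewrite !dE => /(mulfI xi0) yz; apply/rowP => j; rewrite (iE j).
have [q Kq pq] : exists2 q, K q & dotv x p < dotv x q.
  apply: contrapT => hq; have Kp1 : K `<=` [set p].
    move=> y Ky; apply: xy_inj; apply: le_anti; rewrite hmin// andbT leNgt.
    by apply/negP => ypx; apply: hq; exists y.
  have : (lebesgue_rV R d K <= lebesgue_rV R d [set p])%E.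
    apply: le_measure Kp1; rewrite inE//.
    exact: (measurable_compact_rV (@compact_set1 _ p)).
  by rewrite lebesgue_rV_set1 ?d1// leNgt K0.
have xi : 0 < `|x ord0 i| by rewrite normr_gt0.
pose D := dotv x q - dotv x p; have D0 : 0 < D by rewrite subr_gt0.
exists (`|x ord0 i|)^-1, (Num.min 1 D); split; first by rewrite invr_gt0.
  by rewrite lt_min ltr01.
move=> e /andP[e0]; rewrite le_min => /andP[e1 eD].
have e2D : e ^+ 2 <= D by apply: le_trans eD; rewrite expr2 ler_piMl// ltW.
(* The interval is the sheared box with [a = 0]: as [d = 1], the factor [(2 * 0) ^+ d.-1] is
   [0 ^+ 0 = 1]. *)
have xE (t : R) : t^-1 * e ^+ d.+1 = (2 * 0) ^+ d.-1 * (e ^+ 2 / t).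
  by rewrite d1 expr0 mul1r mulrC.
have -> : `|x ord0 i|^-1 * e ^+ d.+1 = (2 * 0) ^+ d.-1 * (e ^+ 2 / `|x ord0 i|).
  exact: xE.
rewrite -(@lebesgue_sheared_box _ _ i x p 0 (dotv x p))//; last exact: sqr_ge0.
apply: le_measure; rewrite ?inE.
- exact: measurable_sheared_box.
- apply: measurableI => //; rewrite -[X in measurable X]setTI.
  rewrite (_ : [set _ | _] = dotv x @^-1` `]-oo, dotv x p + e ^+ 2]); last first.
    by apply/seteqP; split => y /=; rewrite in_itv.
  exact: measurable_dotv.
move=> y [_ /andP[y1 y2]]; split=> //=.
(* Barycentric coordinate of [y] on the segment. *)
pose l := (dotv x q - dotv x y) / D.
have l0 : 0 <= l by rewrite divr_ge0 ?(ltW D0)// subr_ge0; move: e2D; rewrite /D; lra.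
have l1 : l <= 1 by rewrite ler_pdivrMr// mul1r lerB.
have := cvK p q (Itv01 l0 l1); rewrite !inE => /(_ Kp Kq).
suff -> : y = l *: p + (1 - l) *: q by [].
apply: xy_inj; rewrite dotvD !dotvZ /l; move: D0; rewrite /D => D0.
by field; rewrite lt0r_neq0.
Qed.

Lemma convex_body_cap_volume K x : (0 < d)%N -> convex_set K -> compact K ->
  (0 < lebesgue_rV R d K)%E -> ((1 < d)%N -> exists k, boundary_class k.+2 K) ->
  x != 0 ->
  exists s0 c e0 : R, [/\ 0 < c, 0 < e0, forall y, K y -> s0 <= dotv x y &
    forall e, 0 < e <= e0 -> ((c * e ^+ d.+1)%:E <=
     lebesgue_rV R d (K `&` [set y | (dotv x y <= s0 + e ^+ 2)%R]))%E].
Proof.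
move=> d0 cvK cK Kgt0 bK x0.
have K0 : K !=set0.
  by apply/set0P; apply/negP => /eqP K0; move: Kgt0; rewrite K0 measure0 ltxx.
have [p Kp hmin] := linear_minimizer x cK K0.
suff [c [e0 [c0 e00 h]]] : exists c e0 : R, [/\ 0 < c, 0 < e0 & forall e, 0 < e <= e0 ->
    ((c * e ^+ d.+1)%:E <=
     lebesgue_rV R d (K `&` [set y | (dotv x y <= dotv x p + e ^+ 2)%R]))%E].
  by exists (dotv x p), c, e0; split.
move: d0; rewrite leq_eqVlt => /predU1P[/esym d1|d1].
  exact: segment_cap_volume.
by have [k bk] := bK d1; exact: smooth_cap_volume bk Kp hmin.
Qed.

End convex_body_cap.

(** * Weighted averages of the Fourier transform *)

Section fourier_modulus.
Context (R : realType) (d : nat) (K : set 'rV[R]_d).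
Hypotheses (mK : measurable K) (K_fin : (lebesgue_rV R d K < +oo)%E).

Let mu := lebesgue_rV R d.
Let V := fine (mu K).

Let V_ge0 : 0 <= V.
Proof. exact: fine_ge0. Qed.

Lemma integrable_bounded_on (g : 'rV[R]_d -> R) (M : R) : measurable_fun setT g ->
  (forall y, `|g y| <= M) -> mu.-integrable K (EFin \o g).
Proof.
move=> mg gM; apply: measurable_bounded_integrable => //.
  exact: measurable_funTS.
exists M; split; first by rewrite num_real.
by move=> N MN y _ /=; exact: le_trans (gM y) (ltW MN).
Qed.

Let integrable_one : mu.-integrable K (EFin \o (fun=> 1 : R)).
Proof.
by apply: (@integrable_bounded_on _ 1); [exact: measurable_cst|move=> y; rewrite normr1].
Qed.

(** [1 + g] is nonnegative, so Tonelli makes its integral measurable; the volume of [K] is then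
    subtracted. *)
Lemma measurable_Rintegral_param d' (T : measurableType d') (g : T * 'rV[R]_d -> R) :
  measurable_fun setT g -> (forall z, `|g z| <= 1) ->
  measurable_fun setT (fun t => Rintegral mu K (fun y => g (t, y))).
Proof.
move=> mg g1.
have mgt t : measurable_fun setT (fun y => g (t, y)).
  by apply: measurableT_comp => //; exact: measurable_pair1.
have -> : (fun t => Rintegral mu K (fun y => g (t, y))) =
    (fun t => fine (\int[mu]_y ((1 + g (t, y)) * \1_K y)%:E)%E - V).
  apply/funext => t.
  have -> : fine (\int[mu]_y ((1 + g (t, y)) * \1_K y)%:E)%E =
      Rintegral mu K (fun y => 1 + g (t, y)).
    rewrite Rintegral_mkcond /Rintegral; congr fine; apply: eq_integral => y _.
    by rewrite patchE indicE; case: ifP => _; rewrite ?mulr1 ?mulr0.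
  rewrite RintegralD//; last first.
    exact: (integrable_bounded_on (mgt t) (fun y => g1 (t, y))).
  by rewrite Rintegral_cst// mul1r addrAC subrr add0r.
apply: measurable_funB => //; apply: measurableT_comp => //.
pose f (z : T * 'rV[R]_d) := ((1 + g z) * \1_K z.2)%:E.
apply: (@measurable_fun_fubini_tonelli_F _ _ T 'rV[R]_d R mu f).
  apply/measurable_EFinP; apply: measurable_funM.
    exact: measurable_funD.
  by apply: measurableT_comp => //; exact: measurable_indic.
move=> z; rewrite lee_fin mulr_ge0//; have := g1 z; rewrite ler_norml; lra.
Qed.

Definition fourier_cos x : R := Rintegral mu K (fun y => cos (dotv y x)).
Definition fourier_sin x : R := Rintegral mu K (fun y => sin (dotv y x)).
Definition fourier_sqr x : R := fourier_cos x ^+ 2 + fourier_sin x ^+ 2.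

Lemma measurable_dotv2 :
  measurable_fun setT (fun z : 'rV[R]_d * 'rV[R]_d => dotv z.2 z.1).
Proof.
apply: measurable_sum => i; apply: measurable_funM.
  exact: (measurableT_comp (measurable_coord i) measurable_snd).
exact: (measurableT_comp (measurable_coord i) measurable_fst).
Qed.

Lemma measurable_cos_comp d' (T : measurableType d') (g : T -> R) :
  measurable_fun setT g -> measurable_fun setT (fun t => cos (g t)).
Proof. by apply: measurableT_comp; exact: continuous_measurable_fun (@continuous_cos R). Qed.

Lemma measurable_sin_comp d' (T : measurableType d') (g : T -> R) :
  measurable_fun setT g -> measurable_fun setT (fun t => sin (g t)).
Proof. by apply: measurableT_comp; exact: continuous_measurable_fun (@continuous_sin R). Qed.

Lemma measurable_fourier_cos : measurable_fun setT fourier_cos.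
Proof.
apply: (@measurable_Rintegral_param _ _ (fun z => cos (dotv z.2 z.1))).
  exact: measurable_cos_comp measurable_dotv2.
by move=> z; exact: cos_max.
Qed.

Lemma measurable_fourier_sin : measurable_fun setT fourier_sin.
Proof.
apply: (@measurable_Rintegral_param _ _ (fun z => sin (dotv z.2 z.1))).
  exact: measurable_sin_comp measurable_dotv2.
by move=> z; exact: sin_max.
Qed.

Lemma measurable_fourier_sqr : measurable_fun setT fourier_sqr.
Proof.
by apply: measurable_funD; apply: measurable_funX;
  [exact: measurable_fourier_cos|exact: measurable_fourier_sin].
Qed.

Lemma fourier_sqr_ge0 x : 0 <= fourier_sqr x.
Proof. by rewrite addr_ge0// sqr_ge0. Qed.

Lemma normr_Rintegral_le_vol (g : 'rV[R]_d -> R) : measurable_fun setT g ->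
  (forall y, `|g y| <= 1) -> `|Rintegral mu K g| <= V.
Proof.
move=> mg g1; have ig := integrable_bounded_on mg g1.
rewrite (le_trans (le_normr_Rintegral mK ig))//.
rewrite -[leRHS]mul1r -Rintegral_cst//; apply: le_Rintegral => //.
by apply: (@integrable_bounded_on _ 1) => [|y]; [exact: measurableT_comp|rewrite normr_id].
Qed.

Lemma fourier_sqr_le x : fourier_sqr x <= 2 * V ^+ 2.
Proof.
have bound (g : 'rV[R]_d -> R) : measurable_fun setT g -> (forall y, `|g y| <= 1) ->
    (Rintegral mu K g) ^+ 2 <= V ^+ 2.
  move=> mg g1; rewrite -real_normK ?num_real// ler_pXn2r ?nnegrE//.
  exact: normr_Rintegral_le_vol.
have mx : measurable_fun setT (fun y : 'rV[R]_d => dotv y x).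
  by under eq_fun do rewrite dotvC; exact: measurable_dotv.
have -> : 2 * V ^+ 2 = V ^+ 2 + V ^+ 2 by ring.
apply: lerD; apply: bound.
- exact: measurable_cos_comp.
- by move=> y; exact: cos_max.
- exact: measurable_sin_comp.
- by move=> y; exact: sin_max.
Qed.

End fourier_modulus.

(** * From the kernel averaged over the body to the squared Fourier transform *)

Section gamma_average.
Context (R : realType) (d : nat) (K : set 'rV[R]_d).
Hypotheses (mK : measurable K) (K_fin : (lebesgue_rV R d K < +oo)%E).
Variable m : nat.

Let mu := lebesgue_rV R d.
Let leb := @lebesgue_measure R.

Let measurable_weight : measurable_fun setT (@gamma_weight R m).
Proof. exact: continuous_measurable_fun (@continuous_gamma_weight R m). Qed.

Section phase.
Variable phase : 'rV[R]_d -> R.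
Hypothesis measurable_phase : measurable_fun setT phase.

Let f (z : 'rV[R]_d * R) : R :=
  \1_K z.1 * (\1_(`[0, +oo[%classic) z.2 * (gamma_weight m z.2 * cos (phase z.1 * z.2))).

Let measurable_f : measurable_fun setT f.
Proof.
apply: measurable_funM.
  by apply: measurableT_comp => //; exact: measurable_indic.
apply: measurable_funM.
  by apply: measurableT_comp => //; exact: measurable_indic.
apply: measurable_funM; first exact: measurableT_comp.
apply: measurable_cos_comp; apply: measurable_funM => //.
exact: measurableT_comp.
Qed.

Let integrable_f : (mu \x leb)%E.-integrable setT (EFin \o f).
Proof.
apply/integrable12ltyP; first exact/measurable_EFinP.
apply: (@le_lt_trans _ _ (\int[mu]_(y in K) (m`!%:R)%:E)%E); last first.
  by rewrite integral_cst// -[X in (_ * X)%E]fineK ?ge0_fin_numE// -EFinM ltry.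
rewrite [leRHS]integral_mkcond; apply: ge0_le_integral => //.
- by move=> y _; exact: integral_ge0.
- apply: (@measurable_fun_fubini_tonelli_F _ _ _ _ R leb (fun z => `|(f z)%:E|)%E) => //.
  by apply: measurableT_comp => //; exact/measurable_EFinP.
- exact: (measurable_restrictT _ mK).1 (measurable_cst _).
move=> y _; rewrite patchE; case: ifPn => yK; last first.
  rewrite integral0_eq// => r _.
  by rewrite /f /= indicE (negbTE yK) mul0r normr0.
rewrite -integral_gamma_weight [leRHS]integral_mkcond; apply: ge0_le_integral => //.
- apply: measurableT_comp => //; apply/measurable_EFinP.
  by apply: measurableT_comp => //; exact: measurable_pair1.
- apply/(measurable_restrictT _ _).1 => //.
  exact/measurable_EFinP/measurable_funTS.
move=> r _; rewrite patchE /f /= !indicE yK mul1r; case: ifP => r0.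
  have g0 : 0 <= gamma_weight m r by apply: gamma_weight_ge0; rewrite inE/= in_itv/= andbT in r0.
  by rewrite mul1r lee_fin normrM ger0_norm// ler_piMr// cos_max.
by rewrite mul0r normr0.
Qed.

Let cos_phase_integrable y :
  leb.-integrable `[0, +oo[ (fun r => (gamma_weight m r * cos (phase y * r))%:E).
Proof.
apply: integrable_gamma_weightM => [|r]; last exact: cos_max.
exact/measurable_cos_comp/measurable_funM.
Qed.

Let kernel_sectionE : fubini_F leb (EFin \o f) =
  (fun y => (gamma_kernel m (phase y))%:E) \_ K.
Proof.
apply/funext => y; rewrite /fubini_F patchE; case: ifPn => yK; last first.
  by rewrite integral0_eq// => r _; rewrite /f /= indicE (negbTE yK) mul0r.
rewrite /gamma_kernel /Rintegral fineK; last exact: integrable_fin_num.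
rewrite [RHS]integral_mkcond; apply: eq_integral => r _.
rewrite patchE /f /= !indicE yK mul1r; case: ifP => r0; last by rewrite mul0r.
by rewrite mul1r.
Qed.

Let weight_sectionE : fubini_G mu (EFin \o f) =
  (fun r => (gamma_weight m r * Rintegral mu K (fun y => cos (phase y * r)))%:E)
  \_ `[0, +oo[.
Proof.
apply/funext => r; rewrite /fubini_G patchE; case: ifPn => r0; last first.
  by rewrite integral0_eq// => y _; rewrite /f /= !indicE (negbTE r0) mul0r mulr0.
have ic : mu.-integrable K (EFin \o (fun y => cos (phase y * r))).
  apply: (@integrable_bounded_on _ _ _ mK K_fin _ 1) => [|y]; last exact: cos_max.
  exact/measurable_cos_comp/measurable_funM.
rewrite -RintegralZl// /Rintegral fineK; last first.
  by apply: integrable_fin_num => //; have := integrableZl mK (gamma_weight m r) ic.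
rewrite [RHS]integral_mkcond; apply: eq_integral => y _.
rewrite patchE /f /= !indicE r0 mul1r; case: ifP => yK; last by rewrite mul0r.
by rewrite mul1r.
Qed.

Lemma integrable_gamma_kernel_comp :
  mu.-integrable K (fun y => (gamma_kernel m (phase y))%:E).
Proof.
by apply/(integrable_mkcond _ mK); rewrite -kernel_sectionE; exact: integrable_fubini_F.
Qed.

Lemma gamma_kernel_fubini :
  Rintegral mu K (fun y => gamma_kernel m (phase y)) =
  Rintegral leb `[0, +oo[ (fun r =>
    gamma_weight m r * Rintegral mu K (fun y => cos (phase y * r))).
Proof.
rewrite /Rintegral; congr fine; rewrite integral_mkcond [RHS]integral_mkcond.
by rewrite -kernel_sectionE -weight_sectionE; exact: (@Fubini _ _ _ _ _ mu leb (EFin \o f)).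
Qed.

End phase.

Section lower_bound.
Variables (x : 'rV[R]_d) (s0 lambda L : R).

(** If [s0] bounds the form below on [K] and [lambda > 0], the phase is at least [L] on [K]; a large
    [L] puts it where the kernel is positive. *)
Let phase y := lambda * (dotv x y - s0) + L.

Let measurable_phase : measurable_fun setT phase.
Proof.
apply: measurable_funD => //; apply: measurable_funM => //.
by apply: measurable_funB => //; exact: measurable_dotv.
Qed.

Let N r := fourier_sqr K ((lambda * r) *: x).

(** The left side is the real part of [e^(ib) F(z)], hence at most [|F(z)|], and AM-GM makes the
    bound linear in [|F(z)|^2]. *)
Let cos_phase_le r (t : R) : 0 < t ->
  Rintegral mu K (fun y => cos (phase y * r)) <= t / 2 + N r / (2 * t).
Proof.
move=> t0; pose z := (lambda * r) *: x; pose b := r * (L - lambda * s0).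
have -> : Rintegral mu K (fun y => cos (phase y * r)) =
    cos b * fourier_cos K z - sin b * fourier_sin K z.
  have mz : measurable_fun setT (fun y : 'rV[R]_d => dotv y z).
    by under eq_fun do rewrite dotvC; exact: measurable_dotv.
  have ic : mu.-integrable K (EFin \o (fun y => cos (dotv y z))).
    apply: (@integrable_bounded_on _ _ _ mK K_fin _ 1) => [|y]; last exact: cos_max.
    exact: measurable_cos_comp.
  have is_ : mu.-integrable K (EFin \o (fun y => sin (dotv y z))).
    apply: (@integrable_bounded_on _ _ _ mK K_fin _ 1) => [|y]; last exact: sin_max.
    exact: measurable_sin_comp.
  rewrite /fourier_cos /fourier_sin -!RintegralZl// -RintegralB//; first last.
  - by have := integrableZl mK (sin b) is_.
  - by have := integrableZl mK (cos b) ic.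
  apply: eq_Rintegral => y _; rewrite -cosD; congr cos.
  by rewrite /phase /b /z dotvZ dotvC; ring.
have := cos2Dsin2 b; rewrite -/(N r) /N /fourier_sqr -/z.
move: (cos b) (sin b) (fourier_cos K z) (fourier_sin K z) => c s C S cs1.
have h : (c * C - s * S) ^+ 2 <= C ^+ 2 + S ^+ 2.
  have -> : C ^+ 2 + S ^+ 2 = (c * C - s * S) ^+ 2 + (s * C + c * S) ^+ 2.
    transitivity ((c ^+ 2 + s ^+ 2) * (C ^+ 2 + S ^+ 2)); first by rewrite cs1 mul1r.
    by ring.
  by rewrite lerDl sqr_ge0.
have -> : t / 2 + (C ^+ 2 + S ^+ 2) / (2 * t) = (t ^+ 2 + (C ^+ 2 + S ^+ 2)) / (2 * t).
  by field; rewrite lt0r_neq0.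
rewrite ler_pdivlMr ?mulr_gt0//; have := sqr_ge0 (c * C - s * S - t); nra.
Qed.

Let measurable_N : measurable_fun setT N.
Proof.
apply: measurableT_comp; first exact: measurable_fourier_sqr.
apply: measurable_fun_rV => i; under eq_fun do rewrite mxE.
by apply: measurable_funM => //; exact: measurable_funM.
Qed.

Lemma integrable_gamma_fourier_sqr : leb.-integrable `[0, +oo[
  (EFin \o (fun r => gamma_weight m r * N r)).
Proof.
pose M := 2 * (fine (mu K)) ^+ 2.
have iM : leb.-integrable `[0, +oo[ (fun r => (M%:E * (gamma_weight m r)%:E)%E).
  by apply: integrableZl => //; exact: integrable_gamma_weight.
apply: le_integrable iM => //.
  by apply/measurable_EFinP; apply: measurable_funTS; exact: measurable_funM.
move=> r /=; rewrite in_itv/= andbT => r0.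
have w0 := gamma_weight_ge0 m r0; have N0 : 0 <= N r by exact: fourier_sqr_ge0.
have M0 : 0 <= M by rewrite mulr_ge0 ?sqr_ge0.
rewrite lee_fin [leLHS]normrM [leRHS]normrM (ger0_norm w0) (ger0_norm N0) (ger0_norm M0).
rewrite mulrC ler_wpM2r//.
exact: fourier_sqr_le.
Qed.

(* AM-GM with the optimal t = a / m! stands in for the Cauchy-Schwarz inequality. *)
Lemma gamma_average_le (a : R) : 0 < a ->
  a <= Rintegral mu K (fun y => gamma_kernel m (phase y)) ->
  a ^+ 2 <= m`!%:R * Rintegral leb `[0, +oo[ (fun r => gamma_weight m r * N r).
Proof.
move=> a0 aA; set W := Rintegral leb _ _.
have f0 : 0 < m`!%:R :> R by rewrite ltr0n fact_gt0.
pose t := a / m`!%:R; have t0 : 0 < t by rewrite divr_gt0.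
have iw := @integrable_gamma_weight R m.
have iN := integrable_gamma_fourier_sqr.
have iwt : leb.-integrable `[0, +oo[ (EFin \o (fun r => t / 2 * gamma_weight m r)).
  have h : leb.-integrable `[0, +oo[ (fun r => ((t / 2)%:E * (gamma_weight m r)%:E)%E).
    by apply: integrableZl.
  exact: h.
have iNt : leb.-integrable `[0, +oo[ (EFin \o (fun r => (2 * t)^-1 * (gamma_weight m r * N r))).
  have h : leb.-integrable `[0, +oo[
      (fun r => ((2 * t)^-1%:E * (gamma_weight m r * N r)%:E)%E).
    by apply: integrableZl.
  exact: h.
(* With this [t] the first term is [a / 2], which leaves [a / 2 <= m! W / (2a)]. *)
suff : a <= t / 2 * m`!%:R + (2 * t)^-1 * W.
  rewrite /t; have -> : a / m`!%:R / 2 * m`!%:R = a / 2 by field; rewrite lt0r_neq0.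
  have -> : (2 * (a / m`!%:R))^-1 = m`!%:R / (2 * a) by field; rewrite !lt0r_neq0.
  move=> h; have : a / 2 <= m`!%:R / (2 * a) * W by lra.
  rewrite mulrAC ler_pdivlMr ?mulr_gt0//.
  by rewrite (_ : a / 2 * (2 * a) = a ^+ 2)//; field.
rewrite (le_trans aA)// (gamma_kernel_fubini measurable_phase).
have -> : t / 2 * m`!%:R + (2 * t)^-1 * W = Rintegral leb `[0, +oo[
    (fun r => t / 2 * gamma_weight m r + (2 * t)^-1 * (gamma_weight m r * N r)).
  rewrite RintegralD//; congr (_ + _); last by rewrite RintegralZl.
  by rewrite RintegralZl// /Rintegral integral_gamma_weight.
apply: le_Rintegral => //; last first.
- move=> r; rewrite /= in_itv/= andbT => r0.
  have -> : t / 2 * gamma_weight m r + (2 * t)^-1 * (gamma_weight m r * N r) =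
    gamma_weight m r * (t / 2 + N r / (2 * t)) by ring.
  by rewrite ler_wpM2l ?gamma_weight_ge0// cos_phase_le.
- have h : leb.-integrable `[0, +oo[ (fun r => ((t / 2 * gamma_weight m r)%:E +
      ((2 * t)^-1 * (gamma_weight m r * N r))%:E)%E) by apply: integrableD.
  exact: h.
have mc : measurable_fun setT (fun z : R * 'rV[R]_d => cos (phase z.2 * z.1)).
  by apply: measurable_cos_comp; apply: measurable_funM => //; exact: measurableT_comp.
have mC := @measurable_Rintegral_param _ _ _ mK K_fin _ _ _ mc (fun z => cos_max _).
pose v := fine (mu K).
have iv : leb.-integrable `[0, +oo[ (fun r => (v%:E * (gamma_weight m r)%:E)%E).
  by apply: integrableZl => //; exact: integrable_gamma_weight.
apply: le_integrable iv => //.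
  by apply/measurable_EFinP; apply: measurable_funTS; exact: measurable_funM.
move=> r /=; rewrite in_itv/= andbT => r0.
have v0 : 0 <= v by exact: fine_ge0.
have w0 := gamma_weight_ge0 m r0.
rewrite lee_fin [leLHS]normrM [leRHS]normrM (ger0_norm w0) (ger0_norm v0) mulrC ler_wpM2r// normr_Rintegral_le_vol// => [|y].
  exact/measurable_cos_comp/measurable_funM.
exact: cos_max.
Qed.

End lower_bound.

End gamma_average.

(** * Lower and upper bounds for the weighted average *)

Section decay.
Context (R : realType) (d : nat) (K : set 'rV[R]_d).
Hypotheses (mK : measurable K) (K_fin : (lebesgue_rV R d K < +oo)%E).
Variable m : nat.
Hypothesis m4 : (4 %| m.+1)%N.

Let mu := lebesgue_rV R d.
Let leb := @lebesgue_measure R.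

Definition gamma_fourier_average (lambda : R) (x : 'rV[R]_d) : R :=
  Rintegral leb `[0, +oo[ (fun r => gamma_weight m r * fourier_sqr K ((lambda * r) *: x)).

Let slab x s : set 'rV[R]_d := [set y | dotv x y <= s].

Let measurable_slab x s : measurable (slab x s).
Proof.
rewrite -[X in measurable X]setTI (_ : slab x s = dotv x @^-1` `]-oo, s]).
  exact: measurable_dotv.
by apply/seteqP; split => y /=; rewrite in_itv.
Qed.

(** The kernel is nonnegative on all of [K], and on the slab the phase lies between [L] and [L + 1].
    There the bound of [gamma_kernel_lb], decreasing in [s], is at least its value [c1] at
    [L + 1]. *)
Let kernel_average_lb : exists L c1 : R, 0 < c1 /\ forall x s0 lambda, 0 < lambda ->
  (forall y, K y -> s0 <= dotv x y) ->
  c1 * fine (mu (K `&` slab x (s0 + lambda^-1))) <=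
  Rintegral mu K (fun y => gamma_kernel m (lambda * (dotv x y - s0) + L)).
Proof.
have [L L1 hL] := @gamma_kernel_lb R m m4.
pose c1 : R := m`!%:R * (2^-1 * (2 * (L + 1)) ^- m.+1).
have f0 : 0 < m`!%:R :> R by rewrite ltr0n fact_gt0.
have c10 : 0 < c1 by rewrite !mulr_gt0// ?invr_gt0 ?exprn_gt0 ?mulr_gt0//; lra.
exists L, c1; split => // x s0 lambda lambda0 hs0.
have mS : measurable (K `&` slab x (s0 + lambda^-1)) by exact: measurableI.
rewrite -Rintegral_cst// Rintegral_mkcondr; apply: le_Rintegral => //.
- have := @integrable_bounded_on _ _ _ mK K_fin ((fun=> c1) \_ (slab x (s0 + lambda^-1))) c1.
  apply; first exact: (measurable_restrictT _ (measurable_slab _ _)).1 (measurable_cst _).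
  by move=> y; rewrite patchE; case: ifP; rewrite ?normr0 ?(ger0_norm (ltW c10)) ?(ltW c10).
- apply: integrable_gamma_kernel_comp => //.
  apply: measurable_funD => //; apply: measurable_funM => //.
  by apply: measurable_funB => //; exact: measurable_dotv.
move=> y Ky; have ys0 := hs0 _ Ky.
have Ls : L <= lambda * (dotv x y - s0) + L by rewrite lerDr mulr_ge0 ?subr_ge0// ltW.
have hy := hL _ Ls.
have pos (s : R) : L <= s -> 0 < (2 * s) ^- m.+1.
  by move=> ?; rewrite invr_gt0 exprn_gt0// mulr_gt0//; lra.
rewrite patchE; case: ifPn => [|_]; last first.
  by apply: le_trans hy; rewrite !mulr_ge0 ?(ltW f0)// ltW// pos.
rewrite inE /slab/= => ys; apply: le_trans hy; rewrite /c1 ler_pM2l// ler_pM2l//.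
have sL : lambda * (dotv x y - s0) + L <= L + 1.
  rewrite addrC lerD2l -ler_pdivlMl// mulr1; lra.
rewrite lef_pV2 ?posrE ?exprn_gt0 ?mulr_gt0//; [|lra|lra].
by rewrite ler_pXn2r ?nnegrE ?mulr_ge0 ?ler_pM2l//; lra.
Qed.

(** Taking [lambda = J^2] and [e = 1 / J] matches the slab width [1 / lambda] with [e^2] without
    roots. The kernel average is then at least [c1 c J^-(d+1)], whose square is of order
    [lambda^-(d+1)]. *)
Lemma gamma_fourier_average_lb x s0 c e0 : 0 < c -> 0 < e0 ->
  (forall y, K y -> s0 <= dotv x y) ->
  (forall e, 0 < e <= e0 -> ((c * e ^+ d.+1)%:E <=
     lebesgue_rV R d (K `&` [set y | (dotv x y <= s0 + e ^+ 2)%R]))%E) ->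
  exists c2 : R, exists2 n0 : nat, 0 < c2 & forall j, (n0 <= j)%N ->
    c2 <= (j.+1%:R ^+ 2) ^+ d.+1 * gamma_fourier_average (j.+1%:R ^+ 2) x.
Proof.
move=> c0 e00 hs0 hcap; have [L [c1 [c10 h1]]] := kernel_average_lb.
have f0 : 0 < m`!%:R :> R by rewrite ltr0n fact_gt0.
have [n0 _ hn0] := @near_infty_natSinv_lt R (PosNum e00).
exists ((c1 * c) ^+ 2 / m`!%:R), n0; first by rewrite divr_gt0 ?exprn_gt0 ?mulr_gt0.
move=> j /hn0/= je0; set J : R := j.+1%:R; have J0 : 0 < J by rewrite ltr0n.
have eJ : 0 < J^-1 <= e0 by rewrite invr_gt0 J0 ltW.
have J20 : 0 < J ^+ 2 by rewrite exprn_gt0.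
have a0 : 0 < c1 * (c * J^-1 ^+ d.+1) by rewrite !mulr_gt0 ?exprn_gt0 ?invr_gt0.
have {a0} : (c1 * (c * J^-1 ^+ d.+1)) ^+ 2 <= m`!%:R * gamma_fourier_average (J ^+ 2) x.
  apply: (@gamma_average_le _ _ _ mK K_fin m x s0 (J ^+ 2) L) a0 _.
  apply: le_trans (h1 _ _ _ J20 hs0); rewrite ler_pM2l// -exprVn.
  rewrite -lee_fin fineK; first exact: hcap.
  rewrite ge0_fin_numE//; apply: le_lt_trans K_fin.
  by apply: le_measure; rewrite ?inE//; exact: measurableI.
have -> : (c1 * (c * J^-1 ^+ d.+1)) ^+ 2 = (c1 * c) ^+ 2 / (J ^+ 2) ^+ d.+1.
  rewrite mulrA exprMn; congr (_ * _).
  by rewrite !exprVn -!exprM mulnC.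
rewrite ler_pdivrMr ?exprn_gt0// => h.
rewrite ler_pdivrMr//; apply: le_trans h _.
by rewrite mulrC [leRHS]mulrAC -mulrA.
Qed.

Let measurable_weight : measurable_fun setT (@gamma_weight R m).
Proof. exact: continuous_measurable_fun (@continuous_gamma_weight R m). Qed.

Section upper_bound.
Variables (sigma : {finite_measure set 'rV[R]_d -> \bar R}) (C theta : R).
Hypotheses (C_ge0 : 0 <= C) (theta_lt0 : theta < 0) (m_theta : - theta < m%:R).
Hypothesis sigma_le : forall r, 0 < r ->
  (\int[sigma]_x (fourier_sqr K (r *: x))%:E <= (C * r `^ theta)%:E)%E.

Variable lambda : R.
Hypothesis lambda_gt0 : 0 < lambda.

Let f (z : 'rV[R]_d * R) : R := \1_(`[0, +oo[%classic) z.2 *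
  (gamma_weight m z.2 * fourier_sqr K ((lambda * z.2) *: z.1)).

Let f_ge0 z : 0 <= f z.
Proof.
rewrite /f /= indicE; case: (boolP (z.2 \in _)) => [|_]; last by rewrite mul0r.
rewrite inE/= in_itv/= andbT => r0.
by rewrite mul1r mulr_ge0 ?gamma_weight_ge0 ?fourier_sqr_ge0.
Qed.

Let measurable_f : measurable_fun setT f.
Proof.
apply: measurable_funM.
  by apply: measurableT_comp => //; exact: measurable_indic.
apply: measurable_funM; first exact: measurableT_comp.
apply: measurableT_comp; first exact: measurable_fourier_sqr.
apply: measurable_fun_rV => i; under eq_fun do rewrite mxE.
apply: measurable_funM; first exact: measurable_funM.
exact: (measurableT_comp (measurable_coord i) measurable_fst).
Qed.

Let averageE x : (gamma_fourier_average lambda x)%:E = (\int[leb]_r (f (x, r))%:E)%E.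
Proof.
rewrite /gamma_fourier_average /Rintegral fineK; last first.
  by apply: integrable_fin_num => //; exact: integrable_gamma_fourier_sqr.
rewrite integral_mkcond; apply: eq_integral => r _; rewrite patchE /f /= indicE.
by case: (r \in _); rewrite ?mul1r ?mul0r.
Qed.

Lemma measurable_gamma_fourier_average : measurable_fun setT (gamma_fourier_average lambda).
Proof.
apply/measurable_EFinP; rewrite (_ : _ \o _ = fubini_F leb (EFin \o f)).
  by apply: measurable_fun_fubini_tonelli_F => [|z]; [exact/measurable_EFinP|rewrite lee_fin].
by apply/funext => x; exact: averageE.
Qed.

Lemma gamma_fourier_average_ge0 x : 0 <= gamma_fourier_average lambda x.
Proof. by rewrite -lee_fin averageE integral_ge0// => r _; rewrite lee_fin. Qed.

(** For [r >= 1], [r^theta <= 1]; for [r < 1], [r^(m + theta) <= 1] because [m > - theta], which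
    leaves the weight [e^(-r)] of index 0. *)
Let weight_powR_le r : 0 < r ->
  gamma_weight m r * (lambda * r) `^ theta <=
  lambda `^ theta * (gamma_weight 0 r + gamma_weight m r).
Proof.
move=> r0; rewrite powRM ?(ltW lambda_gt0) ?(ltW r0)// mulrCA ler_wpM2l ?powR_ge0//.
rewrite /gamma_weight expr0 -mulrDl mulrAC.
rewrite ler_wpM2r ?expR_ge0//.
have [r1|r1] := leP 1 r.
  have : r ^+ m * r `^ theta <= r ^+ m.
    rewrite ler_piMr ?exprn_ge0 ?(ltW r0)//.
    by rewrite -[leRHS](powRr0 r) ler_powR// ltW.
  lra.
have mt : 0 < m%:R + theta by rewrite -ltrBlDr sub0r.
have : r ^+ m * r `^ theta <= 1.
  rewrite -powR_mulrn ?(ltW r0)// -powRD ?(gt_eqF mt)//.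
  rewrite -[leRHS](powRr0 r); by apply: ger_powR; rewrite ?r0 ?(ltW r1) ?(ltW mt).
have := exprn_ge0 m (ltW r0); lra.
Qed.

(** Tonelli puts the [sigma]-integral inside, where [sigma_le] applies at [lambda r]; the factor
    [1 + m!] is the sum of the integrals of the weights of index 0 and [m]. *)
Lemma integral_gamma_fourier_average_le :
  (\int[sigma]_x (gamma_fourier_average lambda x)%:E <=
   (C * (lambda `^ theta * (1 + m`!%:R)))%:E)%E.
Proof.
under eq_integral do rewrite averageE.
rewrite (@fubini_tonelli _ _ _ _ _ sigma leb (EFin \o f)); [|exact/measurable_EFinP|by move=> z; rewrite lee_fin].
pose g r : R := C * lambda `^ theta * gamma_weight 0 r + C * lambda `^ theta * gamma_weight m r.
have g_ge0 r : 0 <= r -> 0 <= g r.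
  by move=> r0; apply: addr_ge0; apply: mulr_ge0; rewrite ?gamma_weight_ge0//;
    exact: mulr_ge0 C_ge0 (powR_ge0 _ _).
have mg : measurable_fun setT g.
  apply: measurable_funD; apply: measurable_funM => //.
  exact: continuous_measurable_fun (@continuous_gamma_weight R 0).
apply: (@le_trans _ _ (\int[leb]_(r in `[0%R, +oo[) (g r)%:E)%E); last first.
  have a0 : 0 <= C * lambda `^ theta by rewrite mulr_ge0 ?powR_ge0.
  have int_w n : (\int[leb]_(r in `[0%R, +oo[) (C * lambda `^ theta * gamma_weight n r)%:E =
      (C * lambda `^ theta * n`!%:R)%:E)%E.
    under eq_integral do rewrite EFinM.
    rewrite ge0_integralZl//=.
    - by rewrite integral_gamma_weight -EFinM.
    - apply/measurable_EFinP/measurable_funTS.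
      exact: continuous_measurable_fun (@continuous_gamma_weight R n).
    - by move=> r; rewrite /= in_itv/= andbT => r0; rewrite lee_fin gamma_weight_ge0.
  have mw n : measurable_fun (`[0%R, +oo[%classic : set R)
      (fun r : R => (C * lambda `^ theta * gamma_weight n r)%:E).
    apply/measurable_EFinP/measurable_funTS; apply: measurable_funM => //.
    exact: continuous_measurable_fun (@continuous_gamma_weight R n).
  have w0 n (r : R) : (`[0%R, +oo[%classic : set R) r -> (0 <= (C * lambda `^ theta * gamma_weight n r)%:E)%E.
    by rewrite /= in_itv/= andbT => r0; rewrite lee_fin (mulr_ge0 a0)// gamma_weight_ge0.
  under eq_integral do rewrite EFinD.
  rewrite ge0_integralD//; [|exact: w0|exact: mw|exact: w0|exact: mw].
  by rewrite !int_w -EFinD fact0 lee_fin mulr1 mulrA mulrDr mulr1.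
rewrite [leRHS]integral_mkcond; apply: ge0_le_integral => //.
- by move=> r _; apply: integral_ge0 => x _; rewrite lee_fin.
- by apply: (@measurable_fun_fubini_tonelli_G _ _ _ _ R sigma (EFin \o f)) => [|z]; [exact/measurable_EFinP|rewrite lee_fin].
- apply/(measurable_restrictT _ _).1 => //.
  exact/measurable_EFinP/measurable_funTS.
move=> r _; rewrite patchE; case: ifPn => r0; last first.
  by rewrite integral0_eq// => x _; rewrite /f /= indicE (negbTE r0) mul0r.
have w0 : 0 <= gamma_weight m r by apply: gamma_weight_ge0; rewrite inE/= in_itv/= andbT in r0.
have -> : (\int[sigma]_x (EFin \o f) (x, r) =
    (gamma_weight m r)%:E * \int[sigma]_x (fourier_sqr K ((lambda * r) *: x))%:E)%E.
  rewrite -ge0_integralZl//.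
  - by apply: eq_integral => x _; rewrite /f /= indicE r0 mul1r EFinM.
  - apply/measurable_EFinP; apply: measurableT_comp; first exact: measurable_fourier_sqr.
    apply: measurable_fun_rV => i; under eq_fun do rewrite mxE.
    by apply: measurable_funM => //; exact: measurable_coord.
  - by move=> x _; rewrite lee_fin fourier_sqr_ge0.
(* [sigma_le] covers [r > 0] only; at [r = 0] the weight vanishes because [m > 0]. *)
move: (r0); rewrite inE/= in_itv/= andbT le_eqVlt => /predU1P[r00|r_gt0].
  have m0 : (0 < m)%N by rewrite -(ltr_nat R) (lt_trans _ m_theta)// oppr_gt0.
  have -> : gamma_weight m r = 0 by rewrite -r00 /gamma_weight expr0n (gtn_eqF m0) mul0r.
  by rewrite mul0e lee_fin g_ge0// -r00.
apply: (@le_trans _ _ ((gamma_weight m r)%:E * (C * (lambda * r) `^ theta)%:E)%E).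
  by rewrite lee_wpmul2l ?lee_fin// sigma_le// mulr_gt0.
rewrite -EFinM lee_fin /g -mulrDr mulrCA -mulrA ler_wpM2l//.
exact: weight_powR_le.
Qed.

End upper_bound.

End decay.

(** * Vanishing of the spectral measure *)

(** [A] is covered by the sets [E n] on which [u j >= 1 / (n + 1)] for all [j >= n]. Markov's
    inequality bounds the mass of [E n] by [(n + 1) b j], which is arbitrarily small along some
    [j >= n]. *)
Lemma null_of_vanishing_integrals (R : realType) d' (T : measurableType d')
    (sigma : {measure set T -> \bar R}) (u : nat -> T -> R) (b : nat -> R) (A : set T) :
  measurable A -> (forall j, measurable_fun setT (u j)) -> (forall j x, 0 <= u j x) ->
  (forall j, (\int[sigma]_x (u j x)%:E <= (b j)%:E)%E) ->
  (forall n e, 0 < e -> exists2 j, (n <= j)%N & b j < e) ->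
  (forall x, A x -> exists c : R, exists2 n, 0 < c & forall j, (n <= j)%N -> c <= u j x) ->
  sigma A = 0%E.
Proof.
move=> mA mu u0 ub b0 hA.
pose G n j := [set x | n.+1%:R^-1 <= u j x].
have mG n j : measurable (G n j).
  rewrite -[X in measurable X]setTI (_ : G n j = u j @^-1` `[n.+1%:R^-1, +oo[).
    exact: mu.
  by apply/seteqP; split => x /=; rewrite in_itv/= andbT.
pose E n := \bigcap_(j in [set j | (n <= j)%N]) G n j.
have mE n : measurable (E n) by apply: bigcap_measurable => //; exists n => /=.
have E0 n : sigma (E n) = 0%E.
  have n0 : 0 < n.+1%:R :> R by rewrite ltr0n.
  have hn j : (n <= j)%N -> (sigma (E n) <= (n.+1%:R * b j)%:E)%E.
    move=> nj; apply: (@le_trans _ _ (n.+1%:R%:E * \int[sigma]_x (u j x)%:E)%E).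
      have -> : sigma (E n) = (n.+1%:R%:E * (n.+1%:R^-1%:E * sigma (E n)))%E.
        by rewrite muleA -EFinM mulfV ?lt0r_neq0// mul1e.
      rewrite lee_wpmul2l ?lee_fin ?(ltW n0)// -integral_cst//.
      apply: (@le_trans _ _ (\int[sigma]_(x in E n) (u j x)%:E)%E).
        apply: ge0_le_integral => //.
        - by move=> x _; rewrite lee_fin invr_ge0.
        - by apply/measurable_EFinP; exact: measurable_funTS.
        - by move=> x Ex; rewrite lee_fin; exact: Ex.
      apply: ge0_subset_integral => //; first exact/measurable_EFinP.
      by move=> x _; rewrite lee_fin.
    by rewrite EFinM lee_wpmul2l ?lee_fin ?(ltW n0)// ub.
  apply/eqP; rewrite eq_le measure_ge0 andbT; apply/lee_addgt0Pr => e e0.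
  rewrite add0e; have [j nj bj] := b0 n (e / n.+1%:R) (divr_gt0 e0 n0).
  apply: le_trans (hn j nj) _; rewrite lee_fin mulrC -ler_pdivlMr//; exact: ltW.
have AE : A `<=` \bigcup_n E n.
  move=> x /hA[c [n c0 hc]].
  have [N _ hN] := @near_infty_natSinv_lt R (PosNum c0).
  exists (maxn n N) => // j /= nj; rewrite /G/=.
  rewrite (le_trans (ltW (hN _ (leq_maxr n N))))//= hc//.
  exact: leq_trans (leq_maxl _ _) nj.
apply/negligibleP => //; apply: negligibleS AE _; apply: negligible_bigcup => n.
by exists (E n); split.
Qed.

Lemma powR_vanishing (R : realType) (C k : R) : k < 0 ->
  forall (n : nat) (e : R), 0 < e -> exists2 j, (n <= j)%N &
    C * (j.+1%:R ^+ 2) `^ k < e.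
Proof.
move=> k0 n e e0; have nk : 0 < - k by rewrite oppr_gt0.
pose D := `|C| + 1; have D0 : 0 < D by rewrite ltr_wpDl.
(* Solution of [X^(-k) = D / e]; adding 1 to [|C|] keeps [D] positive. *)
pose X := (D / e) `^ (- k)^-1.
have [N] : exists N : nat, X < N%:R.
  by exists (Num.bound X); exact/archi_boundP/powR_ge0.
move=> XN; exists (maxn n N); first exact: leq_maxl.
set j := maxn n N; set J : R := j.+1%:R.
have J1 : 1 <= J by rewrite ler1n.
have J0 : 0 < J by rewrite ltr0n.
have XJ : X < J ^+ 2.
  apply: (@lt_le_trans _ _ J); last by rewrite expr2 ler_peMr// ltW.
  by apply: lt_le_trans XN _; rewrite ler_nat ltnW// ltnS leq_maxr.
have De : D / e < (J ^+ 2) `^ (- k).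
  have -> : D / e = X `^ (- k).
    by rewrite -powRrM mulVf ?lt0r_neq0// powRr1// divr_ge0// ltW.
  by rewrite gt0_ltr_powR// ?nnegrE ?powR_ge0 ?exprn_ge0// ltW.
have P0 : 0 < (J ^+ 2) `^ (- k) by rewrite powR_gt0 ?exprn_gt0.
rewrite -[X in _ `^ X]opprK powRN ltr_pdivrMr//.
have : D < (J ^+ 2) `^ (- k) * e by rewrite -ltr_pdivrMr.
rewrite mulrC; apply: le_lt_trans.
by rewrite (le_trans (ler_norm _))// lerDl.
Qed.

Lemma averaging_errorE (R : realType) (d : nat) (K : set 'rV[R]_d)
    (sigma : {finite_measure set 'rV[R]_d -> \bar R}) (r : R) :
  averaging_error K sigma (const_mx r) =
  (\int[sigma]_x ((fine (lebesgue_rV R d K)) ^- 2 * fourier_sqr K (r *: x))%:E)%E.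
Proof.
apply: eq_integral => x _; congr EFin.
have -> : odot x (const_mx r) = r *: x.
  by apply/rowP => i; rewrite !mxE mulrC.
rewrite ComplexField.Normc.normcM exprMn /= expr0n addr0 sqrtr_sqr -normrX ger0_norm ?sqr_ge0//.
by rewrite exprVn sqr_sqrtr// addr_ge0// sqr_ge0.
Qed.

(** For [r >= T] the hypothesis is used on the diagonal, where homogeneity gives
    [phi = r^theta phi(1, ..., 1)]. For [r < T] the integral is at most [2 V^2 S], and
    [r^theta >= T^theta] since [theta < 0]. *)
Lemma fourier_sqr_integral_decay (R : realType) (d : nat) (K : set 'rV[R]_d)
    (sigma : {finite_measure set 'rV[R]_d -> \bar R}) (theta : R) (phi : 'rV[R]_d -> R) (C T : R) :
  measurable K -> (0 < lebesgue_rV R d K < +oo)%E ->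
  (forall t, orthant t -> 0 < phi t) -> homogeneous theta phi -> theta < 0 ->
  0 < C -> 0 < T ->
  (forall t, orthant t -> (forall i, T <= t ord0 i) ->
     (averaging_error K sigma t <= (C * phi t)%:E)%E) ->
  exists2 C' : R, 0 <= C' & forall r, 0 < r ->
    (\int[sigma]_x (fourier_sqr K (r *: x))%:E <= (C' * r `^ theta)%:E)%E.
Proof.
move=> mK /andP[K0 Koo] phi_pos phi_hom theta0 C0 T0 hC.
pose V := fine (lebesgue_rV R d K).
have V0 : 0 < V by rewrite fine_gt0// K0.
pose one : 'rV[R]_d := const_mx 1.
have one_orthant : orthant one by move=> i; rewrite mxE.
pose S := fine (sigma setT).
have SE : sigma setT = S%:E by rewrite fineK// fin_num_measure.
have S0 : 0 <= S by exact: fine_ge0.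
have mN (r : R) : measurable_fun setT (fun x : 'rV[R]_d => fourier_sqr K (r *: x)).
  apply: measurableT_comp; first exact: measurable_fourier_sqr.
  apply: measurable_fun_rV => i; under eq_fun do rewrite mxE.
  by apply: measurable_funM => //; exact: measurable_coord.
(* [C1] serves [r >= T] and [C2] serves [r < T]; their sum serves both. *)
pose C1 := V ^+ 2 * (C * phi one); pose C2 := 2 * V ^+ 2 * S * (T `^ theta)^-1.
have C1_ge0 : 0 <= C1 by apply: mulr_ge0; [exact: sqr_ge0|apply/ltW/mulr_gt0/phi_pos].
have C2_ge0 : 0 <= C2.
  by rewrite divr_ge0 ?powR_ge0// mulr_ge0// mulr_ge0// sqr_ge0.
exists (C1 + C2) => [|r r0]; first exact: addr_ge0.
have [Tr|rT] := leP T r.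
  have rE : const_mx r = r *: one by apply/rowP => i; rewrite !mxE mulr1.
  have := hC (const_mx r); rewrite averaging_errorE -/V rE phi_hom// => h.
  have {}h : (\int[sigma]_x (V ^- 2 * fourier_sqr K (r *: x))%:E <=
      (C * (r `^ theta * phi one))%:E)%E.
    by apply: h => [i|i]; rewrite !mxE mulr1.
  have -> : (\int[sigma]_x (fourier_sqr K (r *: x))%:E =
      (V ^+ 2)%:E * \int[sigma]_x (V ^- 2 * fourier_sqr K (r *: x))%:E)%E.
    rewrite -ge0_integralZl//.
    - apply: eq_integral => x _; rewrite -EFinM mulrA mulfV ?mul1r//.
      by rewrite expf_neq0// lt0r_neq0.
    - by apply/measurable_EFinP; exact: measurable_funM.
    - by move=> x _; rewrite lee_fin mulr_ge0 ?fourier_sqr_ge0// invr_ge0 sqr_ge0.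
    - by rewrite lee_fin sqr_ge0.
  apply: (@le_trans _ _ (C1 * r `^ theta)%:E); last first.
    by rewrite lee_fin ler_wpM2r ?powR_ge0// lerDl.
  have -> : C1 * r `^ theta = V ^+ 2 * (C * (r `^ theta * phi one)).
    by rewrite /C1; ring.
  by rewrite [leRHS]EFinM lee_wpmul2l ?lee_fin ?sqr_ge0.
apply: (@le_trans _ _ (\int[sigma]_x (2 * V ^+ 2)%:E)%E).
  apply: ge0_le_integral => //.
  - by move=> x _; rewrite lee_fin fourier_sqr_ge0.
  - exact/measurable_EFinP.
  - by move=> x _; rewrite lee_fin fourier_sqr_le.
have -> : (\int[sigma]_x (2 * V ^+ 2)%:E = (2 * V ^+ 2 * S)%:E)%E.
  by rewrite integral_cst// [RHS]EFinM; congr (_ * _)%E; exact: SE.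
rewrite lee_fin.
apply: (@le_trans _ _ (C2 * r `^ theta)); last by rewrite ler_wpM2r ?powR_ge0// lerDr.
rewrite /C2 -[leRHS]mulrA ler_peMr//; first by rewrite mulr_ge0// mulr_ge0// sqr_ge0.
rewrite mulrC ler_pdivlMr ?powR_gt0// mul1r.
have rt := powR_gt0 (- theta) r0; have Tt := powR_gt0 (- theta) T0.
rewrite -[theta]opprK !(powRN _ (- theta)) lef_pV2 ?posrE//.
by rewrite ge0_ler_powR ?nnegrE ?oppr_ge0 ?(ltW theta0) ?(ltW rT) ?(ltW r0) ?(ltW T0).
Qed.

Theorem theorem3 (R : realType) (d : nat) (hd : (1 <= d)%N)
    (K : set 'rV[R]_d) (k : nat)
    (K_convex : convex_set K) (K_compact : compact K)
    (K_vol : (0 < lebesgue_rV R d K < +oo)%E)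
    (hk : Num.max 1 ((d%:R - 1) / 2) < k%:R :> R)
    (K_boundary : (1 < d)%N -> boundary_class k K /\ positively_curved K)
    (H : completeNormedModType R[i]) (dot : {dot H for Num.conj})
    (H_hilbert : hilbert dot)
    (U : 'rV[R]_d -> {linear H -> H}) (U_rep : unitary_rep dot U)
    (P : H -> H) (P_proj : orthogonal_projection dot (fixed_by U) P)
    (h : H) (sigma : {finite_measure set 'rV[R]_d -> \bar R})
    (sigma_spec : spectral_measure dot U (h - P h) sigma)
    (theta : R) (phi : 'rV[R]_d -> R)
    (phi_pos : forall t, orthant t -> 0 < phi t)
    (phi_hom : homogeneous theta phi)
    (htheta : theta < - (d%:R + 1)) :
  (exists C T : R, [/\ 0 < C, 0 < T &
     forall t, orthant t -> (forall i, T <= t ord0 i) ->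
       (averaging_error K sigma t <= (C * phi t)%:E)%E]) <->
  (forall A : set 'rV[R]_d, measurable A -> sigma A = 0%E).
Proof.
have [K0 Koo] := andP K_vol.
have d0 : 0 <= d%:R :> R by exact: ler0n.
have theta0 : theta < 0 by lra.
have mK := measurable_compact_rV K_compact.
split=> [[C [T [C0 T0 hC]]]|sigma0]; last first.
  (* Under the zero measure the error is 0, which is below the positive [phi t]. *)
  exists 1, 1; split => // t t0 _; rewrite mul1r.
  rewrite /averaging_error (@eq_measure_integral _ _ _ _ mzero)//.
    by rewrite integral_measure_zero lee_fin ltW// phi_pos.
  by move=> A mA _; exact: sigma0.
have sigma_0 : sigma [set 0] = 0%E.
  apply: (spectral_measure_atom0 H_hilbert U_rep sigma_spec) => g hg.
  exact: (P_proj h).2.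
have [C' C'0 hC'] := fourier_sqr_integral_decay mK K_vol phi_pos phi_hom theta0 C0 T0 hC.
have [n hn] : exists n : nat, - theta < n%:R.
  by exists (Num.bound (- theta)); apply: archi_boundP; rewrite oppr_ge0 ltW.
(* Makes [m + 1] a multiple of 4, for the positivity of the kernel, and [m > - theta], for
   integrability near [r = 0]. *)
pose m := (4 * n + 3)%N.
have m4 : (4 %| m.+1)%N by rewrite /m -addnS dvdn_add// dvdn_mulr.
have mtheta : - theta < m%:R.
  by apply: lt_le_trans hn _; rewrite ler_nat /m mulSn -addnA leq_addr.
(* [hk] gives [k > 1], hence [k = k' + 2]: the boundary is at least C^2. *)
have bK : (1 < d)%N -> exists k', boundary_class k'.+2 K.
  move=> d1; have [+ _] := K_boundary d1.
  have : 1 < k%:R :> R by apply: le_lt_trans hk; rewrite le_max lexx.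
  rewrite ltr1n; case: (k) => [|[|k']]// _ hb; by exists k'.
have sq0 (j : nat) : 0 < j.+1%:R ^+ 2 :> R by rewrite exprn_gt0.
have mX : measurable (~` [set (0 : 'rV[R]_d)]).
  by apply: measurableC; exact: measurable_origin.
(* With [lambda = (j + 1)^2], the factor [lambda^(d+1)] keeps [u j x] away from 0 at each [x != 0],
   whereas its integral is of order [lambda^(theta + d + 1)], which tends to 0 by [htheta]. *)
pose u j x : R := (j.+1%:R ^+ 2) ^+ d.+1 * gamma_fourier_average K m (j.+1%:R ^+ 2) x.
have sigma_n0 : sigma (~` [set 0]) = 0%E.
  pose D := C' * (1 + m`!%:R).
  apply: (@null_of_vanishing_integrals _ _ _ _ u
    (fun j => D * (j.+1%:R ^+ 2) `^ (theta + d.+1%:R))) => //.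
  - by move=> j; apply: measurable_funM => //; exact: measurable_gamma_fourier_average.
  - move=> j x; rewrite mulr_ge0 ?exprn_ge0 ?(ltW (sq0 j))//.
    exact: gamma_fourier_average_ge0.
  - move=> j; under eq_integral do rewrite EFinM.
    rewrite ge0_integralZl//; first last.
    + by move=> x _; rewrite lee_fin gamma_fourier_average_ge0.
    + by apply/measurable_EFinP; exact: measurable_gamma_fourier_average.
    have hle := integral_gamma_fourier_average_le mK Koo C'0 theta0 mtheta hC' (sq0 j).
    apply: (@le_trans _ _ (((j.+1%:R ^+ 2) ^+ d.+1)%:E *
        (C' * ((j.+1%:R ^+ 2) `^ theta * (1 + m`!%:R)))%:E)%E).
      by apply: lee_wpmul2l => //; rewrite lee_fin ?exprn_ge0.
    rewrite -EFinM lee_fin powRD; last first.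
      by rewrite (gt_eqF (sq0 j)) implybT.
    rewrite powR_mulrn ?(ltW (sq0 j))// /D.
    by rewrite le_eqVlt; apply/orP; left; apply/eqP; ring.
  - by apply: powR_vanishing; rewrite -natr1; lra.
  - move=> x /= /eqP x0.
    have [s0 [c [e0 [c0 e00 hs0 hcap]]]] :=
      convex_body_cap_volume hd K_convex K_compact K0 bK x0.
    exact: gamma_fourier_average_lb hcap.
move=> A mA; apply/eqP; rewrite eq_le measure_ge0 andbT.
have -> : 0%E = (sigma [set 0%R] + sigma (~` [set 0%R]))%E :> \bar R.
  by rewrite sigma_0 sigma_n0 adde0.
rewrite -measureU ?setICr//; last exact: measurable_origin.
by rewrite setUCr; apply: le_measure; rewrite ?inE.
Qed.
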